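(* The Conjunctive Query Finite Determinacy Problem is undecidable. That is, there is no algorithm which, given a relational signature $\Sigma$, a finite set $\mathcal Q=\{Q_1,\dots,Q_k\}$ of conjunctive queries over $\Sigma$ and a conjunctive query $Q_0$ over $\Sigma$, decides whether $\mathcal Q$ finitely determines $Q_0$.
   Context: A relational signature $\Sigma$ consists of relation symbols (with arities) and possibly constants; a structure over $\Sigma$ (database instance) interprets every constant as an element of the domain. A conjunctive query (CQ) $Q(\bar x)=\exists\bar y\,\Psi(\bar x,\bar y)$ is a conjunction $\Psi$ of atoms whose arguments are variables or constants of $\Sigma$, with some variables existentially quantified; $\bar x$ are its free variables. For a structure $\mathbb D$, ${\mathbb D}\models Q(\bar a)$ means there is a homomorphism from the canonical structure of $\Psi$ into $\mathbb D$ mapping $\bar x$ to $\bar a$ (and constants to themselves), and the view $Q(\mathbb D)$ is the relation $\{\bar a:\mathbb D\models Q(\bar a)\}$. A set $\mathcal Q$ of CQs finitely determines $Q_0$ if for every two finite structures $\mathbb D_1,\mathbb D_2$ over $\Sigma$ such that $Q(\mathbb D_1)=Q(\mathbb D_2)$ for every $Q\in\mathcal Q$, also $Q_0(\mathbb D_1)=Q_0(\mathbb D_2)$. *)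

(* Defs.v *)
From mathcomp Require Import all_boot.
Set Implicit Arguments. Unset Strict Implicit. Unset Printing Implicit Defensive.

(* Partial mu-recursive functions on nat (unary, via Cantor pairing).   *)
Definition cpair (a b : nat) : nat := ((a + b) * (a + b).+1)./2 + b.

Inductive code : Type :=
| CZero | CSucc | CId | CFst | CSnd
| CPair of code & code
| CComp of code & code
| CPrec of code & code
| CMu of code.

Inductive eval : code -> nat -> nat -> Prop :=
| eZero x : eval CZero x 0
| eSucc x : eval CSucc x x.+1
| eId x : eval CId x x
| eFst a b : eval CFst (cpair a b) a
| eSnd a b : eval CSnd (cpair a b) b
| ePair f g x y z : eval f x y -> eval g x z -> eval (CPair f g) x (cpair y z)
| eComp f g x y z : eval g x y -> eval f y z -> eval (CComp f g) x z
| ePrec0 f g a y : eval f a y -> eval (CPrec f g) (cpair a 0) y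
| ePrecS f g a n y z :
    eval (CPrec f g) (cpair a n) y -> eval g (cpair a (cpair n y)) z ->
    eval (CPrec f g) (cpair a n.+1) z
| eMu f x n :
    eval f (cpair x n) 0 ->
    (forall m, m < n -> exists k, eval f (cpair x m) k.+1) ->
    eval (CMu f) x n.

(* A term: (true, i) = constant number i; (false, i) = variable number i. *)
Definition term := (bool * nat)%type.
(* An atom: relation symbol index and argument list. *)
Definition atom := (nat * seq term)%type.
(* A CQ: list of free variables xbar (the answer tuple) and the body Psi;
   all other variables of the body are existentially quantified. *)
Definition cq := (seq nat * seq atom)%type.
(* A signature: arities of relation symbols 0..size-1, and number of constants. *)
Definition signature := (seq nat * nat)%type.
Definition instance := (signature * seq cq * cq)%type.

Definition wf_term (S : signature) (t : term) : bool :=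
  if t.1 then t.2 < S.2 else true.
Definition wf_atom (S : signature) (A : atom) : bool :=
  (A.1 < size S.1) && (size A.2 == nth 0 S.1 A.1) && all (wf_term S) A.2.
Definition wf_cq (S : signature) (q : cq) : bool := all (wf_atom S) q.2.
Definition wf_instance (I : instance) : bool :=
  all (wf_cq I.1.1) I.1.2 && wf_cq I.1.1 I.2.

(* Encoding of instances as natural numbers (MathComp's computable pickle). *)
Definition encode (I : instance) : nat := pickle I.

Record structure := Structure {
  dom : seq nat;
  cst : nat -> nat;
  rel : nat -> seq (seq nat)
}.

Definition wf_structure (S : signature) (D : structure) : Prop :=
  (forall c, c < S.2 -> cst D c \in dom D) /\
  (forall r, r < size S.1 ->
     forall t, t \in rel D r -> (size t == nth 0 S.1 r) && all (mem (dom D)) t) /\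
  (forall r, size S.1 <= r -> rel D r = [::]).

Definition teval (D : structure) (v : nat -> nat) (t : term) : nat :=
  if t.1 then cst D t.2 else v t.2.

Definition atom_holds (D : structure) (v : nat -> nat) (A : atom) : bool :=
  map (teval D v) A.2 \in rel D A.1.

Definition cq_vars (q : cq) : seq nat :=
  q.1 ++ flatten [seq [seq t.2 | t <- A.2 & ~~ t.1] | A <- q.2].

(* D |= Q(a) : there is a homomorphism of the canonical structure into D
   sending xbar to a and constants to themselves. *)
Definition sat (D : structure) (q : cq) (a : seq nat) : Prop :=
  exists v : nat -> nat,
    (forall x, x \in cq_vars q -> v x \in dom D) /\
    map v q.1 = a /\ all (atom_holds D v) q.2.

Definition same_view (q : cq) (D1 D2 : structure) : Prop :=
  forall a, sat D1 q a <-> sat D2 q a.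

Definition finitely_determines (S : signature) (Qs : seq cq) (q0 : cq) : Prop :=
  forall D1 D2, wf_structure S D1 -> wf_structure S D2 ->
    (forall q, q \in Qs -> same_view q D1 D2) -> same_view q0 D1 D2.

Definition FD (I : instance) : Prop := finitely_determines I.1.1 I.1.2 I.2.

(* Main.v *)
Require Import Defs.
From mathcomp Require Import all_boot.
From mathcomp Require Import zify.
From Stdlib Require Import Classical.
Set Implicit Arguments. Unset Strict Implicit. Unset Printing Implicit Defensive.

(* A pair of structures with the same views is read as one structure in two colours,
   green and red. A view that is a conjunction of "spiders" (atoms B(x, y, k_1, ..., k_n)
   with calf atoms C(k_j), some of them missing) then says that facts A(x, y), stored as
   spiders with one calf of the opposite colour, can be rewritten by local rules
   E. A_1 /\ ... /\ A_r <=> E. B_1 /\ ... /\ B_r, in which every fact keeps its pair of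
   variables. Such rules simulate register machines: numbers are paths, time points are
   nodes, and since each time point remembers its predecessor and the instruction that
   was executed, the converse rules only lead back along the run.

   If the run accepts, an accepting fact appears in every pair of structures with equal
   views and green goal, and yields the red goal. If the run rejects, its finite trace is
   a model of all rules without accepting fact, hence a counterexample to determinacy.
   Runs that do not halt never have to be considered: a decision procedure would separate
   the programs that return 1 on their own code from those that return 0, and
   diagonalizing against it gives a contradiction. *)

(** Equal views transmit only the presence of atoms and the values of free variables, never the
    absence of a calf. Hence the exchange of colours: a leg whose calf is left out of a view has a
    free knee, the same element in both structures, and the calf it has in the opposite structure is
    what travels. One rewriting step crosses to the other structure by the view of the rule and
    comes back by the view of a trivial rule. Since a view neither creates nor deletes spiders, both
    sides of a rule have the same items up to labels; [lE]-loops serve as blanks out of which new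
    edges are made. A view cannot be restricted to one direction either, so the trace of a rejecting
    run must be closed under the inverse of every machine step, although overwriting a register
    forgets its value. Finally, the map from inputs to encoded instances must itself be
    mu-recursive. To avoid arithmetizing the compiler, one universal program is compiled once and
    for all, and only the starting number varies with the input. *)

Section Indexed.
Variable T : Type.
Implicit Types (P Q : nat -> T -> Prop) (s : seq T).

(* The index of an entry is the number of entries after it, so that it does
   not change when the list is extended at its head. *)
Fixpoint indexed P s : Prop :=
  if s is x :: s' then P (size s') x /\ indexed P s' else True.

Lemma indexed_impl P Q s :
  (forall i x, P i x -> Q i x) -> indexed P s -> indexed Q s.
Proof. by move=> PQ; elim: s => //= x s IH [/PQ ? /IH]. Qed.

Lemma indexed_and P Q s :
  indexed P s -> indexed Q s -> indexed (fun i x => P i x /\ Q i x) s.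
Proof. by elim: s => //= x s IH [? /IH h] [? /h]. Qed.

(** Finite choice by induction: the head has the fresh index [size s], so the function found for the
    tail changes at one new point only. *)
Lemma indexed_choice (U : Type) (u0 : U) (P : nat -> T -> U -> Prop) s :
  indexed (fun i x => exists u, P i x u) s ->
  exists f : nat -> U, indexed (fun i x => P i x (f i)) s.
Proof.
have ext (g f : nat -> U) s' : (forall i, i < size s' -> f i = g i) ->
    indexed (fun i x => P i x (f i)) s' -> indexed (fun i x => P i x (g i)) s'.
  elim: s' => //= x s' IH fg [Px /IH h]; rewrite -fg //; split=> //.
  by apply: h => i lt_i; apply: fg; rewrite ltnW.
elim: s => [_|x s IH [[u Pu] /IH [f Pf]]] /=; first by exists (fun=> u0).
exists (fun i => if i == size s then u else f i); rewrite eqxx; split=> //.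
apply: ext Pf => i lt_i; by rewrite ltn_eqF.
Qed.

End Indexed.

Lemma indexed_in (T : eqType) (P : nat -> T -> Prop) s x :
  indexed P s -> x \in s -> exists i, P i x.
Proof.
elim: s => //= y s IH [Py /IH h]; rewrite inE => /orP [/eqP ->|/h //].
by exists (size s).
Qed.

Lemma indexed_all (T : eqType) (P : nat -> T -> Prop) s :
  (forall i x, x \in s -> P i x) -> indexed P s.
Proof.
elim: s => //= x s IH h; split; first by apply: h; rewrite mem_head.
by apply: IH => i y ys; apply: h; rewrite inE ys orbT.
Qed.

Lemma indexed_map (T U : Type) (f : T -> U) (P : nat -> U -> Prop) s :
  indexed P (map f s) <-> indexed (fun i x => P i (f x)) s.
Proof. by elim: s => //= x s [h1 h2]; rewrite size_map; split=> -[? /=]; auto. Qed.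

(** * Spider queries *)

(* A spider with [n] legs has a body atom [B(x, y, k_0, ..., k_(n-1))] and calf atoms
   [C(k_j)]; in [(M, (v, w))], [v] and [w] are the variables for [x] and [y] and
   [M] lists the legs whose calf is missing and whose knee is a free variable. *)
Definition spider : Type := seq nat * (nat * nat).

Section Spiders.
Variable n : nat.
Implicit Types (sp : seq spider) (D : structure) (nu : nat -> nat).
Implicit Types (ka : nat -> nat -> nat).

(** Node variables are even and knee variables odd; for [j < n] the number [i * n + j] determines
    the spider and the leg, which lets [valuation] decode it. *)
Definition nvar v : term := (false, v.*2).
Definition kvar i j : term := (false, (i * n + j).*2.+1).

Definition spider_atoms i (s : spider) : seq atom :=
  (0, [:: nvar s.2.1, nvar s.2.2 & [seq kvar i j | j <- iota 0 n]]) ::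
  [seq (1, [:: kvar i j]) | j <- iota 0 n & j \notin s.1].

Fixpoint spiders_atoms sp : seq atom :=
  if sp is s :: sp' then spider_atoms (size sp') s ++ spiders_atoms sp' else [::].

Fixpoint knees sp : seq nat :=
  if sp is s :: sp' then
    [seq (size sp' * n + j).*2.+1 | j <- s.1] ++ knees sp' else [::].

Definition query (fv : seq nat) sp : cq :=
  ([seq v.*2 | v <- fv] ++ knees sp, spiders_atoms sp).

Definition bodyD D x y (k : nat -> nat) : bool :=
  (x :: y :: map k (iota 0 n)) \in Defs.rel D 0.
Definition calf D k : bool := [:: k] \in Defs.rel D 1.

Definition matches D nu ka sp : Prop :=
  indexed (fun i s => bodyD D (nu s.2.1) (nu s.2.2) (ka i) /\
                      (forall j, j < n -> j \notin s.1 -> calf D (ka i j))) sp.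

Fixpoint knee_vals ka sp : seq nat :=
  if sp is s :: sp' then map (ka (size sp')) s.1 ++ knee_vals ka sp' else [::].

Definition nodes sp : seq nat := flatten [seq [:: s.2.1; s.2.2] | s <- sp].

Definition safe (fv : seq nat) sp : bool :=
  all (mem (nodes sp)) fv && all (fun s : spider => all (fun j => j < n) s.1) sp.

Definition sig : signature := ([:: n.+2; 1], 0).

Lemma wf_query fv sp : wf_cq sig (query fv sp).
Proof.
rewrite /wf_cq /=; elim: sp => //= s sp IH; rewrite all_cat IH andbT /= {IH}.
rewrite /wf_atom /= size_map size_iota eqxx /=; apply/andP; split.
  by apply/allP => t /mapP [j _ ->].
by apply/allP => A /mapP [j _ ->].
Qed.

Definition valuation nu ka : nat -> nat :=
  fun m => if odd m then ka (m./2 %/ n) (m./2 %% n) else nu m./2.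

Lemma valuation_nvar nu ka v : valuation nu ka v.*2 = nu v.
Proof. by rewrite /valuation odd_double doubleK. Qed.

Lemma valuation_kvar nu ka i j : j < n -> valuation nu ka (i * n + j).*2.+1 = ka i j.
Proof.
move=> lt_jn; rewrite /valuation /= odd_double /= uphalf_double.
have n_gt0 : 0 < n by apply: leq_ltn_trans lt_jn.
by rewrite divnMDl // modnMDl (divn_small lt_jn) (modn_small lt_jn) addn0.
Qed.

Lemma holds_atomsE D v sp :
  all (atom_holds D v) (spiders_atoms sp) <->
  matches D (fun x => v x.*2) (fun i j => v (i * n + j).*2.+1) sp.
Proof.
elim: sp => //= s sp [IH1 IH2]; rewrite all_cat /= {1}/atom_holds /= /bodyD.
rewrite /teval /= -map_comp.
split.
  case/and3P=> hb /allP hc /IH1 hm; split=> //; split=> // j lt_j jM.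
  apply: (hc (1, [:: kvar (size sp) j])); apply/mapP; exists j => //.
  by rewrite mem_filter jM mem_iota.
case=> [[hb hc] /IH2 ->]; rewrite andbT; apply/andP; split=> //.
apply/allP => A /mapP [j]; rewrite mem_filter mem_iota => /andP [jM lt_j] ->.
exact: hc.
Qed.

Lemma eq_matches D nu nu' ka ka' sp :
  nu =1 nu' -> (forall i j, j < n -> ka i j = ka' i j) ->
  matches D nu ka sp -> matches D nu' ka' sp.
Proof.
move=> en ek; apply: indexed_impl => i s [hb hc]; split.
  rewrite /bodyD -!en; suff <- : map (ka i) (iota 0 n) = map (ka' i) (iota 0 n) by [].
  by apply/eq_in_map => j; rewrite mem_iota => /andP [_]; apply: ek.
by move=> j lt_j jM; rewrite -ek //; apply: hc.
Qed.

Lemma matches_valuation D nu ka sp :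
  matches D nu ka sp -> all (atom_holds D (valuation nu ka)) (spiders_atoms sp).
Proof.
move=> h; apply/holds_atomsE; apply: eq_matches h => [x|i j lt_j].
  by rewrite valuation_nvar.
by rewrite valuation_kvar.
Qed.

Lemma map_knees v sp :
  map v (knees sp) = knee_vals (fun i j => v (i * n + j).*2.+1) sp.
Proof. by elim: sp => //= s sp <-; rewrite map_cat -map_comp. Qed.

Lemma eq_knee_vals ka ka' sp :
  all (fun s : spider => all (fun j => j < n) s.1) sp ->
  (forall i j, j < n -> ka i j = ka' i j) -> knee_vals ka sp = knee_vals ka' sp.
Proof.
move=> hM ek; elim: sp hM => //= s sp IH /andP [/allP hs /IH ->]; congr (_ ++ _).
by apply/eq_in_map => j /hs; apply: ek.
Qed.

Lemma in_knees sp x : x \in knees sp ->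
  exists i s j, [/\ i < size sp, s \in sp, j \in s.1 & x = (i * n + j).*2.+1 /\
    nth s (rev sp) i = s].
Proof.
elim: sp => //= s sp IH; rewrite mem_cat => /orP [/mapP [j js ->]|/IH].
  exists (size sp), s, j; rewrite mem_head ltnSn; split=> //; split=> //.
  by rewrite rev_cons nth_rcons size_rev ltnn eqxx.
case=> i [s' [j [h1 h2 h3 [h4 h5]]]]; exists i, s', j.
rewrite inE h2 orbT ltnW //; split=> //; split=> //.
by rewrite rev_cons nth_rcons size_rev h1.
Qed.

(** Tuples of a well-formed structure lie in its domain, and [safe] makes every free variable occur
    in a body atom; the domain condition of [sat] is therefore automatic. *)
Lemma cq_vars_dom D fv sp v :
  wf_structure sig D -> safe fv sp -> all (atom_holds D v) (spiders_atoms sp) ->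
  forall x, x \in cq_vars (query fv sp) -> v x \in dom D.
Proof.
move=> [_ [wfD _]] /andP [/allP hfv /allP hM] hA.
have bodyvars x : x \in flatten [seq [seq t.2 | t <- A.2 & ~~ t.1] | A <- spiders_atoms sp] ->
    v x \in dom D.
  case/flattenP=> vs /mapP [A As ->] /mapP [t]; rewrite mem_filter => /andP [t1 tA] ->.
  have := allP hA A As; rewrite /atom_holds => hAr.
  have A1 : A.1 < 2.
    move: As; clear; elim: sp => [|s sp IH] //; rewrite mem_cat => /orP [|//].
    by rewrite inE => /orP [/eqP -> //|/mapP [j _ -> //]].
  have /andP [_ /allP hd] := wfD A.1 A1 _ hAr.
  have := hd _ (map_f (teval D v) tA).
  by rewrite /teval (negbTE t1).
(* Spiders are numbered from the end, so spider [i] is entry [i] of the reversed list. *)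
have spin : forall i s, i < size sp -> nth s (rev sp) i = s -> s \in sp ->
    {subset spider_atoms i s <= spiders_atoms sp}.
  elim: sp {hfv hM hA bodyvars} => [|s0 sp IH] i s //.
  rewrite rev_cons nth_rcons size_rev ltnS leq_eqVlt => /orP [/eqP ->|lt_i].
    by rewrite ltnn eqxx => <- _ A hA; rewrite mem_cat hA.
  rewrite lt_i => e _ A hA; rewrite mem_cat (IH i s) ?orbT //.
  by rewrite -e -mem_rev mem_nth // size_rev.
move=> x; rewrite mem_cat => /orP [|]; last exact: bodyvars.
rewrite mem_cat => /orP [/mapP [w /hfv wn ->]|xk].
  apply: bodyvars; case/flattenP: wn => vs /mapP [s ss ->] ws.
  have [i lt_i] : exists2 i, i < size sp & nth s (rev sp) i = s.
    exists (index s (rev sp)); last by rewrite nth_index // mem_rev.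
    by rewrite -size_rev index_mem mem_rev.
  move=> ei; have hb := spin i s lt_i ei ss.
  apply/flattenP; eexists; first by apply/map_f/hb/mem_head.
  by move: ws; rewrite !inE => /orP [] /eqP ->; rewrite /= eqxx ?orbT.
have [i [s [j [lt_i ss js [-> ei]]]]] := in_knees xk.
have hb := spin i s lt_i ei ss.
apply: bodyvars; apply/flattenP; eexists; first by apply/map_f/hb/mem_head.
have lt_j : j < n by have /allP := hM s ss; apply.
rewrite /= !inE; apply/orP; right; apply/orP; right.
apply/mapP; exists (kvar i j) => //; rewrite mem_filter /=.
by apply: map_f; rewrite mem_iota.
Qed.

Lemma sat_query D fv sp a : wf_structure sig D -> safe fv sp ->
  sat D (query fv sp) a <->
  exists nu ka, matches D nu ka sp /\ a = map nu fv ++ knee_vals ka sp.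
Proof.
move=> wfD sf; split.
  case=> v [_ [<- /holds_atomsE hm]]; do 2 eexists; split; first exact: hm.
  by rewrite map_cat map_knees -map_comp.
case=> nu [ka [hm ->]]; exists (valuation nu ka).
have hA := matches_valuation hm; split; first exact: cq_vars_dom.
split=> //; rewrite map_cat map_knees -map_comp; congr (_ ++ _).
  by apply/eq_map => x /=; rewrite valuation_nvar.
have /andP [_ hM] := sf.
by apply: eq_knee_vals => // i j lt_j; rewrite valuation_kvar.
Qed.

(** One inclusion between views, freed of answer tuples: the kept nodes and the free knees are all
    that the two matches share. *)
Definition transfer D1 D2 (fv : seq nat) sp : Prop :=
  forall nu ka, matches D1 nu ka sp -> exists nu' ka',
    [/\ matches D2 nu' ka' sp, {in fv, nu =1 nu'}
      & indexed (fun i s => {in s.1, ka i =1 ka' i}) sp].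

Lemma knee_valsP ka ka' sp :
  knee_vals ka sp = knee_vals ka' sp <->
  indexed (fun i (s : spider) => {in s.1, ka i =1 ka' i}) sp.
Proof.
elim: sp => //= s sp [IH1 IH2]; split.
  move/eqP; rewrite eqseq_cat ?size_map // => /andP [/eqP/eq_in_map h /eqP/IH1 h'].
  by split.
by case=> /eq_in_map -> /IH2 ->.
Qed.

Lemma same_viewP D1 D2 fv sp :
  wf_structure sig D1 -> wf_structure sig D2 -> safe fv sp ->
  same_view (query fv sp) D1 D2 <-> transfer D1 D2 fv sp /\ transfer D2 D1 fv sp.
Proof.
move=> wf1 wf2 sf.
have half E1 E2 : wf_structure sig E1 -> wf_structure sig E2 ->
    transfer E1 E2 fv sp <->
    (forall a, sat E1 (query fv sp) a -> sat E2 (query fv sp) a).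
  move=> w1 w2; split.
    move=> tr a; rewrite !sat_query // => -[nu [ka [hm ->]]].
    have [nu' [ka' [hm' /eq_in_map -> /knee_valsP ->]]] := tr _ _ hm.
    by exists nu', ka'.
  move=> h nu ka hm; have : sat E1 (query fv sp) (map nu fv ++ knee_vals ka sp).
    by rewrite sat_query //; exists nu, ka.
  move/h; rewrite sat_query // => -[nu' [ka' [hm' e]]]; exists nu', ka'.
  move/eqP: e; rewrite eqseq_cat ?size_map // => /andP [/eqP/eq_in_map h1 /eqP/knee_valsP h2].
  by split.
split=> [h|[/half h1 /half h2] a]; last by split=> [/h1|/h2]; auto.
by split; apply/half => // a; case: (h a).
Qed.

End Spiders.

(** * Rule systems *)

(* The item [((A, B), (v, w))] of a rule replaces a fact [A(v, w)] by [B(v, w)]; the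
   variables listed in the first component of a rule are kept, all others are
   existentially quantified on either side. *)
Definition item : Type := (nat * nat) * (nat * nat).
Definition rule : Type := seq nat * seq item.
Definition fact : Type := nat * (nat * nat).

Section Rules.
Implicit Types (F : nat -> nat -> nat -> Prop) (r : rule) (nu : nat -> nat).

Definition lhs F nu r : Prop :=
  forall it : item, it \in r.2 -> F it.1.1 (nu it.2.1) (nu it.2.2).
Definition rhs F nu r : Prop :=
  forall it : item, it \in r.2 -> F it.1.2 (nu it.2.1) (nu it.2.2).
Definition holds F nu (s : seq fact) : Prop :=
  forall f, f \in s -> F f.1 (nu f.2.1) (nu f.2.2).

Definition forward F r : Prop :=
  forall nu, lhs F nu r -> exists2 nu', {in r.1, nu =1 nu'} & rhs F nu' r.
Definition backward F r : Prop :=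
  forall nu, rhs F nu r -> exists2 nu', {in r.1, nu =1 nu'} & lhs F nu' r.

Definition item_nodes (s : seq item) : seq nat := flatten [seq [:: it.2.1; it.2.2] | it <- s].

(** Connectedness of the graph whose edges are the items, phrased with colourings instead of paths
    because it is applied to the classification of nodes into 0, 1 and larger ones. *)
Definition connected r : Prop :=
  forall kind : nat -> nat, (forall it, it \in r.2 -> kind it.2.1 = kind it.2.2) ->
  {in r.2 &, forall it it', kind it.2.1 = kind it'.2.1}.

End Rules.

(** * The determinacy instance of a rule system *)

Section System.
Variables (L b : nat).
Hypothesis bL : b < L.
Local Notation n := (L + L).

(* A fact with label [A] is encoded by a green spider whose [A]-th calf is red, or
   by a red spider whose [(L + A)]-th calf is green. *)
Definition item_spider (it : item) : spider := ([:: it.1.1; L + it.1.2], it.2).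
Definition fact_spider (f : fact) : spider := ([:: L + f.1], f.2).
(** As a rule this is void; its view trades a red spider with green calf [L + A] for a green spider
    with red calf [A] between the same nodes. *)
Definition sync A : rule := ([:: 0; 1], [:: ((A, A), (0, 1))]).
Definition all_rules (rules : seq rule) : seq rule := [seq sync A | A <- iota 0 L] ++ rules.

Definition rule_query (r : rule) : cq := query n r.1 (map item_spider r.2).
Definition init_query (init : seq fact) : cq := query n [::] (map fact_spider init).
Definition goal_query : cq := query n [::] [:: ([::], (0, 0))].
Definition bad_query : cq := query n [::] [:: ([:: b], (0, 0))].

Definition system (init : seq fact) (rules : seq rule) : instance :=
  (sig n, init_query init :: bad_query :: map rule_query (all_rules rules), goal_query).

Definition rule_ok (r : rule) : bool :=
  all (fun it : item => (it.1.1 < L) && (it.1.2 < L)) r.2 &&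
  all (mem (item_nodes r.2)) r.1.

Lemma wf_system init rules : wf_instance (system init rules).
Proof.
rewrite /wf_instance /= !wf_query /= andbT.
by apply/allP => q /mapP [r _ ->]; apply: wf_query.
Qed.

Lemma all_rules_ok rules r : all rule_ok rules -> r \in all_rules rules -> rule_ok r.
Proof.
move=> /allP ok; rewrite mem_cat => /orP [/mapP [A]|/ok //].
by rewrite mem_iota /= add0n => AL ->; rewrite /rule_ok /= AL.
Qed.

Lemma rule_safe r : rule_ok r -> safe n r.1 (map item_spider r.2).
Proof.
case/andP=> /allP hL /allP hfv; apply/andP; split.
  by apply/allP => v /hfv; rewrite /nodes -map_comp.
apply/allP => s /mapP [it /hL /andP [h1 h2] ->] /=.
by rewrite andbT ltn_add2l h2 andbT ltn_addr.
Qed.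

Lemma init_safe (init : seq fact) : all (fun f : fact => f.1 < L) init ->
  safe n [::] (map fact_spider init).
Proof.
move/allP=> hL; apply/allP => s /mapP [f /hL h ->] /=.
by rewrite andbT ltn_add2l.
Qed.

Lemma bad_safe : safe n [::] [:: ([:: b], (0, 0))].
Proof. by rewrite /safe /= !andbT ltn_addr. Qed.

Lemma goal_safe : safe n [::] [:: ([::], (0, 0))].
Proof. by []. Qed.

(** * From an unavoidable accepting fact to determinacy *)

Section Determined.

Definition colored D D' J x y : Prop := exists k,
  [/\ bodyD n D x y k, forall j, j < n -> j != J -> calf D (k j) & calf D' (k J)].

(** The knees [P x] and [Q x] are free, hence the same in the match found in [D']. That match
    supplies the other calves, knee [P x] had its calf in [D'] from the start, and knee [Q x] brings
    its calf in [D] along. *)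
Lemma flip D D' fv (T : eqType) (s : seq T) (vw : T -> nat * nat) (M : T -> seq nat)
    (P Q : T -> nat) nu :
  (forall x, x \in s -> [/\ M x =i [:: P x; Q x], P x != Q x & Q x < n]) ->
  transfer n D D' fv [seq (M x, vw x) | x <- s] ->
  (forall x, x \in s -> colored D D' (P x) (nu (vw x).1) (nu (vw x).2)) ->
  exists2 nu', {in fv, nu =1 nu'} &
    forall x, x \in s -> colored D' D (Q x) (nu' (vw x).1) (nu' (vw x).2).
Proof.
move=> hM tr hc.
have [ka hka] : exists ka : nat -> nat -> nat, indexed (fun i x => x \in s /\
    [/\ bodyD n D (nu (vw x).1) (nu (vw x).2) (ka i),
        forall j, j < n -> j != P x -> calf D (ka i j) & calf D' (ka i (P x))]) s.
  pose R (i : nat) x k := x \in s /\ [/\ bodyD n D (nu (vw x).1) (nu (vw x).2) k,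
    forall j, j < n -> j != P x -> calf D (k j) & calf D' (k (P x))].
  apply: (@indexed_choice _ _ (fun=> 0) R); apply: indexed_all => i x xs.
  by have [k hk] := hc x xs; exists k.
have hm : matches n D nu ka [seq (M x, vw x) | x <- s].
  apply/indexed_map; apply: indexed_impl hka => i x [xs [h1 h2 h3]]; split=> //= j lt_j.
  have [-> _ _] := hM x xs; rewrite !inE negb_or => /andP [jP _]; exact: h2.
have [nu' [ka' [hm' hfv hk]]] := tr _ _ hm.
exists nu' => // x xs; move/indexed_map: hm' => hm'; move/indexed_map: hk => hk.
have [i [[[_ [h1 h2 h3]] [h4 h5]] /= h6]] := indexed_in (indexed_and (indexed_and hka hm') hk) xs.
have [eM PQ Qn] := hM x xs; exists (ka' i); split=> //.
  move=> j lt_j jQ; have [->|jP] := eqVneq j (P x).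
    by rewrite -h6 // eM mem_head.
  by apply: h5 => //=; rewrite eM !inE negb_or jP jQ.
rewrite -h6; last by rewrite eM !inE eqxx orbT.
by apply: h2 => //; rewrite eq_sym.
Qed.

Lemma goal_transfer init rules D1 D2 :
  all (fun f : fact => f.1 < L) init -> all rule_ok rules ->
  (forall F, (exists nu, holds F nu init) -> (forall r, r \in rules -> forward F r) ->
     exists x, F b x x) ->
  wf_structure (sig n) D1 -> wf_structure (sig n) D2 ->
  (forall q, q \in (system init rules).1.2 -> same_view q D1 D2) ->
  forall a, sat D1 goal_query a -> sat D2 goal_query a.
Proof.
move=> okI okR hF wf1 wf2 same a; rewrite !sat_query ?goal_safe //.
case=> nu0 [ka0 [/= [[hb0 hc0] _] ->]].
set x0 := nu0 0 in hb0; set k0 := ka0 0 in hb0 hc0.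
have trR r : r \in all_rules rules ->
    transfer n D1 D2 r.1 (map item_spider r.2) /\ transfer n D2 D1 r.1 (map item_spider r.2).
  move=> rin; apply/same_viewP => //; first exact/rule_safe/(all_rules_ok okR).
  by apply: same; rewrite !inE; apply/orP; right; apply/orP; right; apply: map_f.
have [trI _] : transfer n D1 D2 [::] (map fact_spider init) /\
    transfer n D2 D1 [::] (map fact_spider init).
  by apply/same_viewP => //; [exact: init_safe | apply: same; rewrite mem_head].
have [trB _] : transfer n D1 D2 [::] [:: ([:: b], (0, 0))] /\
    transfer n D2 D1 [::] [:: ([:: b], (0, 0))].
  apply/same_viewP => //; first exact: bad_safe.
  by apply: same; rewrite !inE eqxx orbT.
pose F A x y := colored D1 D2 A x y.
have unsync A x y : A < L -> colored D2 D1 (L + A) x y -> F A x y.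
  move=> AL cA; have Ain : sync A \in all_rules rules.
    by rewrite mem_cat map_f // mem_iota.
  have [_ tr] := trR _ Ain.
  pose nu v := if v == 0 then x else y.
  have [|||nu' hfv h] := @flip D2 D1 [:: 0; 1] _ [:: ((A, A), (0, 1))] (fun it : item => it.2)
    (fun it : item => (item_spider it).1) (fun it : item => L + it.1.2)
    (fun it : item => it.1.1) nu.
  - move=> it; rewrite inE => /eqP -> /=; split; [|lia|lia].
    by move=> j; rewrite !inE orbC.
  - exact: tr.
  - by move=> it; rewrite inE => /eqP ->.
  have := h _ (mem_head _ _); rewrite /= -!hfv //.
have [x [k [hb hc1 hc2]]] : exists x, F b x x.
  apply: hF.
    (* The goal spider is a loop with all its calves, so it alone matches every spider of the
       initial view. *)
    have hm : matches n D1 (fun=> x0) (fun=> k0) (map fact_spider init).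
      by apply/indexed_map; apply: indexed_all => i f _; split=> // j lt_j _; apply: hc0.
    have [nu' [ka' [/indexed_map hm' _ /indexed_map hk]]] := trI _ _ hm.
    exists nu' => f fi; have fL : f.1 < L := allP okI f fi.
    have [i [[h1 h2] h3]] := indexed_in (indexed_and hm' hk) fi.
    apply: unsync => //; exists (ka' i); split=> //=.
      by move=> j lt_j jJ; apply: h2 => //=; rewrite inE.
    by rewrite -h3 /= ?mem_head //; apply: hc0 => //; rewrite ltn_add2l.
  move=> r rin nu hl.
  have rin' : r \in all_rules rules by rewrite mem_cat rin orbT.
  have [tr _] := trR _ rin'.
  have /andP [/allP ok _] := all_rules_ok okR rin'.
  have [|||nu' hfv h] := @flip D1 D2 r.1 _ r.2 (fun it : item => it.2)
    (fun it : item => (item_spider it).1) (fun it : item => it.1.1)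
    (fun it : item => L + it.1.2) nu.
  - move=> it /ok /andP [h1 h2]; split=> //; lia.
  - exact: tr.
  - exact: hl.
  exists nu' => // it itr; apply: unsync; last exact: h.
  by have /andP [] := ok it itr.
(* The knee of leg [b] has its calf in [D2]; the image under the view of [b] keeps this knee and has
   all other calves, so it is a full spider of [D2]. *)
have hm : matches n D1 (fun=> x) (fun=> k) [:: ([:: b], (0, 0))].
  by split=> //; split=> //= j lt_j; rewrite inE => jb; apply: hc1.
have [nu' [ka' [[/= [h1 h2] _] _ [/= h3 _]]]] := trB _ _ hm.
exists nu', ka'; split=> //; split=> //; split=> // j lt_j _ /=.
have [->|jb] := eqVneq j b; first by rewrite -h3 // mem_head.
by apply: h2 => //; rewrite inE.
Qed.

Theorem system_determined init rules :
  all (fun f : fact => f.1 < L) init -> all rule_ok rules ->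
  (forall F, (exists nu, holds F nu init) -> (forall r, r \in rules -> forward F r) ->
     exists x, F b x x) ->
  FD (system init rules).
Proof.
move=> okI okR hF D1 D2 wf1 wf2 same a; split; apply: (goal_transfer okI okR hF) => //.
by move=> q qin a'; split; case: (same q qin a').
Qed.

End Determined.

(** * From a finite model without accepting fact to a counterexample *)

Section Refuted.

(** [P] is an arbitrary proposition, so excluded middle selects among the finitely many tuples; in
    this way a model given by predicates becomes a structure given by lists. *)
Lemma finite_extension (P : seq nat -> Prop) m N : exists s : seq (seq nat),
  forall t, t \in s <-> [/\ size t = m, all (fun x => x < N) t & P t].
Proof.
have sub (T : eqType) (Q : T -> Prop) (s : seq T) :
    exists s' : seq T, forall t, t \in s' <-> t \in s /\ Q t.
  elim: s => [|x s [s' IH]]; first by exists [::] => t; split=> // -[].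
  have [Qx|nQx] := classic (Q x).
    exists (x :: s') => t; rewrite !inE; split.
      by case/orP=> [/eqP ->|/IH [-> ?]]; rewrite ?eqxx ?orbT.
    by case=> /orP [-> //|ts] Qt; apply/orP; right; apply/IH.
  exists s' => t; rewrite inE; split=> [/IH [-> ?]|]; first by rewrite orbT.
  by case=> /orP [/eqP -> //|ts] Qt; apply/IH.
have [s hs] : exists s : seq (seq nat),
    forall t, size t = m -> all (fun x => x < N) t -> t \in s.
  elim: m => [|m [s hs]]; first by exists [:: [::]] => -[].
  exists [seq x :: t | x <- iota 0 N, t <- s] => -[//|x t] [/hs h] /= /andP [xN /h ts].
  by apply: allpairs_f => //; rewrite mem_iota.
have [s' hs'] := sub _ (fun t => [/\ size t = m, all (fun x => x < N) t & P t]) s.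
by exists s' => t; split=> [/hs' []|h] //; apply/hs'; split=> //; case: h => *; apply: hs.
Qed.

Lemma build_structure (N c : nat) (P : nat -> nat -> (nat -> nat) -> Prop) :
  c < N ->
  (forall x y k k', {in iota 0 n, k =1 k'} -> P x y k -> P x y k') ->
  (forall x y k, P x y k -> [/\ x < N, y < N & forall j, j < n -> k j < N]) ->
  exists D, [/\ wf_structure (sig n) D, forall x y k, bodyD n D x y k <-> P x y k
    & forall z, calf D z = (z == c)].
Proof.
move=> cN extP bP.
have [s hs] := finite_extension
  (fun t => exists x y k, t = x :: y :: map k (iota 0 n) /\ P x y k) n.+2 N.
exists (Structure (iota 0 N) (fun=> 0)
  (fun r => if r is 0 then s else if r is 1 then [:: [:: c]] else [::])); split.
- split=> //; split=> [r|]; last by case=> [|[]].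
  have memN : mem (iota 0 N) =1 (fun x => x < N) by move=> x; rewrite /= mem_iota.
  case: r => [|[|//]] /= _ t.
    by case/hs=> -> h _; rewrite eqxx (eq_all memN).
  rewrite inE => /eqP ->; apply/andP; split=> //.
  by rewrite (eq_all memN) /= cN.
- move=> x y k; rewrite /bodyD /=; split.
    case/hs=> _ _ [x' [y' [k' [[-> -> /eq_in_map e] h]]]].
    by apply: extP h => j /e ->.
  move=> h; have [xN yN kN] := bP _ _ _ h; apply/hs; split.
  - by rewrite /= size_map size_iota.
  - rewrite /= xN yN; apply/allP => z /mapP [j]; rewrite mem_iota => /andP [_ lt_j] ->.
    exact: kN.
  - by exists x, y, k.
- by move=> z; rewrite /calf /= inE; apply/eqP/eqP => [[]|->].
Qed.

Variables (init : seq fact) (rules : seq rule).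
Variables (N : nat) (F : nat -> nat -> nat -> Prop).

Hypothesis rules_ok : all rule_ok rules.
Hypothesis rules_connected : forall r, r \in rules -> connected r.
Hypothesis rules_bad : forall r, r \in rules ->
  exists2 it : item, it \in r.2 & it.1.1 != b /\ it.1.2 != b.
Hypothesis init_ok : all (fun f : fact => (f.1 < L) && (f.1 != b)) init.
Hypothesis N_gt1 : 1 < N.
Hypothesis F_nodes : forall A x y, F A x y -> 1 < x < N /\ 1 < y < N.
Hypothesis F_bad : forall x y, ~ F b x y.
Hypothesis F_init : exists nu, holds F nu init.
Hypothesis F_rules : forall r, r \in rules -> forward F r /\ backward F r.

(* Knees are 0 (green calf only) and 1 (red calf only). Node 0 carries the full green
   spider, hence every query is matched there, and node 1 provides a red match for
   the query of [b]. *)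
Definition green x y (k : nat -> nat) : Prop :=
  [\/ [/\ x = 0, y = 0 & forall j, j < n -> k j = 0],
      [/\ x = 1, y = 1 & forall j, j < n -> k j = (j == L + b)]
    | exists A, [/\ A < L, F A x y & forall j, j < n -> k j = (j == A)]].

(** Node 0 has to answer the matches of all rules in the full green spider: for each item it has a
    spider whose two free knees are green. Every red spider keeps some green knee, so none is
    full. *)
Definition red x y (k : nat -> nat) : Prop :=
  [\/ exists r it, [/\ r \in all_rules rules, it \in r.2, x = 0, y = 0 &
        forall j, j < n -> k j = (j \notin (item_spider it).1)],
      [/\ x = 1, y = 1 & forall j, j < n -> k j = (j != b)]
    | exists A, [/\ A < L, F A x y & forall j, j < n -> k j = (j != L + A)]].

Lemma green_structure : exists D, [/\ wf_structure (sig n) D,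
  forall x y k, bodyD n D x y k <-> green x y k & forall z, calf D z = (z == 0)].
Proof.
apply: (@build_structure N); first exact: ltnW.
  move=> x y k k' e; have e' j : j < n -> k' j = k j by move=> h; rewrite e ?mem_iota.
  by case=> [[-> -> h]|[-> -> h]|[A [h1 h2 h]]];
    [constructor 1|constructor 2|constructor 3; exists A]; split=> // j lt_j; rewrite e' ?h.
move=> x y k [[-> -> h]|[-> -> h]|[A [h1 /F_nodes [/andP [_ ->] /andP [_ ->]] h]]].
all: split=> //; try lia; move=> j lt_j; rewrite h //; lia.
Qed.

Lemma red_structure : exists D, [/\ wf_structure (sig n) D,
  forall x y k, bodyD n D x y k <-> red x y k & forall z, calf D z = (z == 1)].
Proof.
apply: (@build_structure N) => //.
  move=> x y k k' e; have e' j : j < n -> k' j = k j by move=> h; rewrite e ?mem_iota.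
  by case=> [[r [it [h1 h2 -> -> h]]]|[-> -> h]|[A [h1 h2 h]]];
    [constructor 1; exists r, it|constructor 2|constructor 3; exists A];
    split=> // j lt_j; rewrite e' ?h.
move=> x y k [[r [it [h1 h2 -> -> h]]]|[-> -> h]|[A [h1 /F_nodes [/andP [_ ->] /andP [_ ->]] h]]].
all: split=> //; try lia; move=> j lt_j; rewrite h //; lia.
Qed.

(** One description for both structures, where [p] and [q] are the values of the free knees [A] and
    [L + B]. Passing from green to red swaps the labels and leaves [p] and [q] alone, so the knees
    agree by themselves. *)
Definition item_match (F' : nat -> nat -> nat -> Prop) (A B : nat) x y p q : Prop :=
  [\/ [/\ x = 0, y = 0, p = 0 & q = 0], [/\ x = 1, y = 1, p = 0, q = 1 & B = b]
    | [/\ F' A x y, p = 1 & q = 0]].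

Lemma green_match A B x y p q : A < L -> B < L ->
  item_match F A B x y p q <->
  exists k, [/\ green x y k, forall j, j < n -> j \notin [:: A; L + B] -> k j = 0,
                k A = p & k (L + B) = q].
Proof.
move=> AL BL; have An : A < n by lia. have Bn : L + B < n by lia.
split.
  case=> [[-> -> -> ->]|[-> -> -> -> eB]|[h -> ->]].
  - by exists (fun=> 0); split=> //; constructor 1.
  - exists (fun j => j == L + b); split; try lia; first by constructor 2.
    by move=> j lt_j; rewrite !inE eB; lia.
  - exists (fun j => j == A); split; try lia; first by constructor 3; exists A.
    by move=> j lt_j; rewrite !inE; lia.
case=> k [[[-> -> h]|[-> -> h]|[A' [h1 h2 h]]] h0 <- <-]; rewrite !h //.
- by constructor 1.
- constructor 2; have : L + b \in [:: A; L + B].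
    by apply: contraT => /h0; rewrite h ?eqxx; lia.
  by rewrite !inE => e; split; lia.
- have eA : A' = A.
    have : A' \in [:: A; L + B] by apply: contraT => /h0; rewrite h ?eqxx; lia.
    by rewrite !inE; lia.
  by rewrite -{1}eA; constructor 3; split=> //; lia.
Qed.

Lemma red_match (r : rule) (it : item) x y p q (A := it.1.1) (B := it.1.2) :
  r \in all_rules rules -> it \in r.2 ->
  item_match F B A x y p q <->
  exists k, [/\ red x y k, forall j, j < n -> j \notin [:: A; L + B] -> k j = 1,
                k A = p & k (L + B) = q].
Proof.
move=> rin itr; have /andP [/allP ok _] := all_rules_ok rules_ok rin.
have /andP [AL BL] : (A < L) && (B < L) := ok _ itr.
have An : A < n by lia. have Bn : L + B < n by lia.
split.
  case=> [[-> -> -> ->]|[-> -> -> -> eB]|[h -> ->]].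
  - exists (fun j => j \notin [:: A; L + B]); split; rewrite ?inE ?eqxx ?orbT //.
      by constructor 1; exists r, it.
    by move=> j _ ->.
  - exists (fun j => j != b); split; try lia; first by constructor 2.
    by move=> j lt_j; rewrite !inE; lia.
  - exists (fun j => j != L + B); split; try lia; first by constructor 3; exists B.
    by move=> j lt_j; rewrite !inE; lia.
case=> k [[[r' [it' [r'in it'r' -> -> h]]]|[-> -> h]|[A' [h1 h2 h]]] h0 <- <-].
(* A spider made for another item [it'] can match here only if its green knees are legs left free by
   [it]; as labels are below [L], both items then have the same labels. *)
- have /andP [/allP ok' _] := all_rules_ok rules_ok r'in.
  have /andP [AL' BL'] := ok' _ it'r'.
  have /= e1 : it'.1.1 \in [:: A; L + B].
    by apply: contraT => /h0; rewrite h ?inE ?eqxx /=; lia.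
  have /= e2 : L + it'.1.2 \in [:: A; L + B].
    by apply: contraT => /h0; rewrite h ?inE ?eqxx /=; lia.
  move: e1 e2; rewrite !inE => e1 e2; rewrite !h //= !inE.
  by constructor 1; split=> //; lia.
- constructor 2; rewrite !h //; have : b \in [:: A; L + B].
    by apply: contraT => /h0; rewrite h ?eqxx; lia.
  by rewrite !inE => e; split; lia.
- have eA : A' = B.
    have : L + A' \in [:: A; L + B] by apply: contraT => /h0; rewrite h ?eqxx; lia.
    by rewrite !inE; lia.
  by rewrite !h // -{1}eA; constructor 3; split=> //; lia.
Qed.

Lemma sync_forward A : forward F (sync A) /\ backward F (sync A).
Proof.
by split=> nu h; exists nu => // it itin; have := h it itin;
  move: itin; rewrite inE => /eqP ->.
Qed.

(* Connectedness forces the items of a matched rule to lie all at node 0, all at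
   node 1 or all at nodes of [F]; [rules_bad] then leaves only [sync b] at node 1. *)
Lemma match_cases r nu (f g : item -> nat) (p q : nat -> item -> nat) :
  r \in all_rules rules ->
  (forall it, it.1 = (f it, g it) \/ it.1 = (g it, f it)) ->
  indexed (fun i it => item_match F (f it) (g it)
    (nu it.2.1) (nu it.2.2) (p i it) (q i it)) r.2 ->
  [\/ forall it, it \in r.2 -> nu it.2.1 = 0 /\ nu it.2.2 = 0,
      r = sync b /\ nu 0 = 1 /\ nu 1 = 1
    | forall it, it \in r.2 -> F (f it) (nu it.2.1) (nu it.2.2)].
Proof.
move=> rin fg hm.
have cases it : it \in r.2 ->
  [\/ nu it.2.1 = 0 /\ nu it.2.2 = 0, [/\ nu it.2.1 = 1, nu it.2.2 = 1 & g it = b]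
    | F (f it) (nu it.2.1) (nu it.2.2)].
  move=> itr; have [i h] := indexed_in hm itr.
  by case: h => [[]|[]|[]] *; [constructor 1|constructor 2|constructor 3].
move: rin; rewrite mem_cat => /orP [/mapP [A _ er]|rin].
  have := cases ((A, A), (0, 1)); rewrite er mem_head => /(_ isT) [[/= h1 h2]|[/= h1 h2 h3]|h].
  - by constructor 1 => it; rewrite inE => /eqP ->.
  - constructor 2; split=> //; suff -> : A = b by [].
    by have [[_ ->]|[-> _]] := fg ((A, A), (0, 1)).
  - by constructor 3 => it; rewrite inE => /eqP ->.
(* Nodes of [F] exceed 1, so [kind] separates node 0, node 1 and the model. *)
pose kind v := minn (nu v) 2.
have hk it : it \in r.2 -> kind it.2.1 = kind it.2.2.
  move=> /cases [[h1 h2]|[h1 h2 _]|/F_nodes [h1 h2]]; rewrite /kind; lia.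
have hc := rules_connected rin hk.
have [it0 it0r [A0 B0]] := rules_bad rin.
have g0 : g it0 != b by have [e|e] := fg it0; move: A0 B0; rewrite e.
have [[h1 h2]|[h1 h2 h3]|h] := cases _ it0r.
- constructor 1 => it itr; move: (hc _ _ it0r itr) (hk _ itr); rewrite /kind h1.
  by set x := nu _; set y := nu _; split; lia.
- by rewrite h3 eqxx in g0.
- constructor 3 => it itr; have [[e1 e2]|[e1 e2 _]|//] := cases _ itr.
  + exfalso; move: (hc _ _ it0r itr) (F_nodes h) => + [+ _]; rewrite /kind e1.
    by set x := nu _; lia.
  + exfalso; move: (hc _ _ it0r itr) (F_nodes h) => + [+ _]; rewrite /kind e1.
    by set x := nu _; lia.
Qed.

Lemma in_item_nodes (s : seq item) v : v \in item_nodes s ->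
  exists2 it : item, it \in s & v = it.2.1 \/ v = it.2.2.
Proof.
case/flattenP=> vs /mapP [it its ->]; rewrite !inE => h; exists it => //.
by case/orP: h => /eqP ->; [left|right].
Qed.

(** Taking the two labels in either order as [f] and [g] covers both colours. Matches at node 0 stay
    there, [sync b] stays at node 1, and only matches inside [F] call upon [step]. *)
Lemma match_step r nu (f g : item -> nat) (p q : nat -> item -> nat) :
  r \in all_rules rules ->
  (forall it, it.1 = (f it, g it) \/ it.1 = (g it, f it)) ->
  (forall mu, (forall it, it \in r.2 -> F (f it) (mu it.2.1) (mu it.2.2)) ->
     exists2 mu', {in r.1, mu =1 mu'} &
       forall it, it \in r.2 -> F (g it) (mu' it.2.1) (mu' it.2.2)) ->
  indexed (fun i it => item_match F (f it) (g it)
    (nu it.2.1) (nu it.2.2) (p i it) (q i it)) r.2 ->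
  exists2 nu', {in r.1, nu =1 nu'} &
    indexed (fun i it => item_match F (g it) (f it)
      (nu' it.2.1) (nu' it.2.2) (p i it) (q i it)) r.2.
Proof.
move=> rin fg step hm; have /andP [_ /allP hfv] := all_rules_ok rules_ok rin.
case: (match_cases rin fg hm) => [h|[er [h0 h1]]|h].
- exists (fun=> 0).
    by move=> v /hfv /in_item_nodes [it /h [e1 e2]] [] ->.
  have := indexed_and (@indexed_all _ (fun _ it => it \in r.2) r.2 (fun _ _ => id)) hm.
  apply: indexed_impl => i it [/h [-> ->]] [[_ _ -> ->]|[] //|[/F_nodes [] //]].
  by constructor 1.
- exists nu => //; move: hm; rewrite er /= h0 h1 => -[hm _]; split=> //.
  case: hm => [[] //|[_ _ -> -> _]|[/F_nodes [] //]].
  by constructor 2; split=> //; case: (fg ((b, b), (0, 1))) => [[e _]|[_ e]].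
- have [mu' hfv' hmu] := step _ h; exists mu' => //.
  have := indexed_and (@indexed_all _ (fun _ it => it \in r.2) r.2 (fun _ _ => id)) hm.
  apply: indexed_impl => i it [itr hi]; have hF := F_nodes (h _ itr).
  case: hi => [[e]|[e]|[_ -> ->]]; rewrite ?e in hF; try by case: hF.
  by constructor 3; split=> //; apply: hmu.
Qed.

Lemma transferI D1 D2 fv sp :
  (forall nu ka, matches n D1 nu ka sp -> exists2 nu', {in fv, nu =1 nu'} &
     indexed (fun i s => exists k, [/\ bodyD n D2 (nu' s.2.1) (nu' s.2.2) k,
       forall j, j < n -> j \notin s.1 -> calf D2 (k j) & {in s.1, ka i =1 k}]) sp) ->
  transfer n D1 D2 fv sp.
Proof.
move=> h nu ka /h [nu' hfv hi].
pose P i (s : spider) k := [/\ bodyD n D2 (nu' s.2.1) (nu' s.2.2) k,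
  forall j, j < n -> j \notin s.1 -> calf D2 (k j) & {in s.1, ka i =1 k}].
have [ka' hka] := @indexed_choice _ _ (fun=> 0) P _ hi.
by exists nu', ka'; split=> //; apply: indexed_impl hka => i s [].
Qed.

Theorem system_not_determined : ~ FD (system init rules).
Proof.
have [G [wfG bG cG]] := green_structure; have [R [wfR bR cR]] := red_structure.
have rok r : r \in all_rules rules -> forall it : item, it \in r.2 ->
    it.1.1 < L /\ it.1.2 < L.
  move=> rin it itr; have /andP [/allP ok _] := all_rules_ok rules_ok rin.
  by have /andP [] := ok it itr.
have Frules r : r \in all_rules rules -> forward F r /\ backward F r.
  rewrite mem_cat => /orP [/mapP [A _ ->]|/F_rules //]; exact: sync_forward.
have green0 k : (forall j, j < n -> k j = 0) -> bodyD n G 0 0 k.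
  by move=> h; apply/bG; constructor 1.
move=> /(_ G R wfG wfR) det.
(* The goal holds in [G] at node 0 and fails in [R], where every spider has a knee 0. *)
suff /det /(_ [::]) [+ _] : forall q, q \in (system init rules).1.2 -> same_view q G R.
  have satG : sat G goal_query [::].
    apply/(sat_query _ wfG goal_safe); exists (fun=> 0), (fun _ _ => 0); split=> //.
    split=> //; split; first exact: green0.
    by move=> j _ _; rewrite cG.
  move/(_ satG)/(sat_query _ wfR goal_safe)=> [nu [ka [[[/= /bR hb hc] _] _]]].
  have h1 j : j < n -> ka 0 j = 1 by move=> lt_j; apply/eqP; rewrite -cR; apply: hc.
  case: hb => [[r [it [rin itr _ _ h]]]|[_ _ h]|[A [AL _ h]]].
  - have [AL _] := rok _ rin _ itr; have An : it.1.1 < n by rewrite ltn_addr.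
    by have := h _ An; rewrite h1 // mem_head.
  - have bn : b < n by lia.
    by have := h _ bn; rewrite h1 // eqxx.
  - have An : L + A < n by lia.
    by have := h _ An; rewrite h1 // eqxx.
move=> q; rewrite !inE => /or3P [/eqP ->|/eqP ->|/mapP [r rin ->]].
- apply/same_viewP => //.
    by apply: init_safe; apply: sub_all init_ok => f /andP [].
  split; apply: transferI => nu ka /indexed_map hm.
    (* In [G] only the full spider fits an initial fact ([f.1 != b] excludes node 1), so its free
       knee is 0, as in the red spider of that fact. *)
    have [nu' hF] := F_init; exists nu' => //; apply/indexed_map.
    have := indexed_and (@indexed_all _ (fun _ f => f \in init) init (fun _ _ => id)) hm.
    apply: indexed_impl => i f [fin [/= /bG hb hc]].
    have /andP [fL fb] := allP init_ok _ fin.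
    have lt_f : L + f.1 < n by rewrite ltn_add2l.
    exists (fun j => j != L + f.1); split.
    + by apply/bR; constructor 3; exists f.1; split=> //; apply: hF.
    + by move=> j lt_j; rewrite inE cR; case: eqP.
    + have {}hc j : j < n -> j != L + f.1 -> ka i j = 0.
        by move=> h1 h2; apply/eqP; rewrite -cG; apply: hc => //; rewrite inE.
      move=> j; rewrite inE => /eqP ->; rewrite eqxx.
      case: hb => [[_ _ ->//]|[_ _ h]|[A [AL _ h]]].
      * have bn : L + b < n by lia.
        have ne : L + b != L + f.1 by rewrite eqn_add2l eq_sym.
        by have := hc _ bn ne; rewrite h // eqxx.
      * have An : A < n by lia.
        have ne : A != L + f.1 by rewrite neq_ltn ltn_addr.
        by have := hc _ An ne; rewrite h // eqxx.
  exists (fun=> 0) => //; apply/indexed_map.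
  have := indexed_and (@indexed_all _ (fun _ f => f \in init) init (fun _ _ => id)) hm.
  apply: indexed_impl => i f [fin [/= /bR hb hc]].
  have /andP [fL fb] := allP init_ok _ fin.
  have lt_f : L + f.1 < n by rewrite ltn_add2l.
  exists (fun=> 0); split; first exact: green0.
    by move=> j _ _; rewrite cG.
  have {}hc j : j < n -> j != L + f.1 -> ka i j = 1.
    by move=> h1 h2; apply/eqP; rewrite -cR; apply: hc => //; rewrite inE.
  move=> j; rewrite inE => /eqP ->.
  case: hb => [[r [it [rin itr _ _ h]]]|[_ _ h]|[A [AL _ h]]].
  + have [AL BL] := rok _ rin _ itr; have An : it.1.1 < n by rewrite ltn_addr.
    have ne : it.1.1 != L + f.1 by rewrite neq_ltn ltn_addr.
    by have := hc _ An ne; rewrite h // mem_head.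
  + have bn : b < n by lia.
    have ne : b != L + f.1 by rewrite neq_ltn ltn_addr.
    by have := hc _ bn ne; rewrite h // eqxx.
  + rewrite h //; have [->|ne] := eqVneq f.1 A; first by rewrite eqxx.
    have An : L + A < n by lia.
    have {}ne : L + A != L + f.1 by rewrite eqn_add2l eq_sym.
    by have := hc _ An ne; rewrite h // eqxx.
- have bn : b < n by lia.
  apply/same_viewP => //; first exact: bad_safe.
  split; apply: transferI => nu ka [[/= hb hc] _]; move: hb.
    move=> /bG hb; exists (fun=> 1) => //; split=> //; exists (fun j => j != b); split.
    + by apply/bR; constructor 2.
    + by move=> j _ /=; rewrite inE cR; case: eqP.
    + have {}hc j : j < n -> j != b -> ka 0 j = 0.
        by move=> h1 h2; apply/eqP; rewrite -cG; apply: hc => //; rewrite inE.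
      move=> j; rewrite inE => /eqP ->; rewrite eqxx.
      case: hb => [[_ _ ->//]|[_ _ ->]|[A [AL hF h]]] //; first by lia.
      have An : A < n by lia.
      have [e|ne] := eqVneq A b; first by case: (@F_bad (nu 0) (nu 0)); rewrite -e.
      by have := hc _ An ne; rewrite h // eqxx.
  move=> /bR hb; exists (fun=> 0) => //; split=> //; exists (fun=> 0); split.
  + exact: green0.
  + by move=> j _ _; rewrite cG.
  + have {}hc j : j < n -> j != b -> ka 0 j = 1.
      by move=> h1 h2; apply/eqP; rewrite -cR; apply: hc => //; rewrite inE.
    move=> j; rewrite inE => /eqP ->.
    case: hb => [[r [it [rin itr _ _ h]]]|[_ _ ->]|[A [AL hF h]]] //; last 2 first.
    * by rewrite eqxx.
    * have An : L + A < n by lia.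
      have ne : L + A != b by rewrite neq_ltn ltn_addr // orbT.
      by have := hc _ An ne; rewrite h // eqxx.
    have [AL BL] := rok _ rin _ itr; have Bn : L + it.1.2 < n by rewrite ltn_add2l.
    have ne : L + it.1.2 != b by rewrite neq_ltn ltn_addr // orbT.
    by have := hc _ Bn ne; rewrite h // !inE eqxx orbT.
- have [fw bw] := Frules _ rin; have sfr := rule_safe (all_rules_ok rules_ok rin).
  have inr := @indexed_all _ (fun _ it => it \in r.2) r.2 (fun _ _ => id).
  apply/same_viewP => //; split; apply: transferI => nu ka /indexed_map hm.
    have [||nu' hfv hm'] := @match_step r nu (fun it => it.1.1) (fun it => it.1.2)
      (fun i it => ka i it.1.1) (fun i it => ka i (L + it.1.2)) rin _ fw.
    - by case=> [[A B] ?]; left.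
    - have := indexed_and inr hm; apply: indexed_impl => i it [itr [/bG h1 h2]].
      have [AL BL] := rok _ rin _ itr; apply/green_match => //; exists (ka i); split=> //.
      by move=> j lt_j jM; apply/eqP; rewrite -cG; apply: h2.
    exists nu' => //; apply/indexed_map; have := indexed_and inr hm'.
    apply: indexed_impl => i it [itr /(red_match _ _ _ _ rin itr) [k [h1 h2 h3 h4]]].
    exists k; split; first exact/bR.
      by move=> j lt_j jM; rewrite cR; apply/eqP; apply: h2.
    by move=> j; rewrite !inE => /orP [] /eqP ->.
  have [||nu' hfv hm'] := @match_step r nu (fun it => it.1.2) (fun it => it.1.1)
    (fun i it => ka i it.1.1) (fun i it => ka i (L + it.1.2)) rin _ bw.
  - by case=> [[A B] ?]; right.
  - have := indexed_and inr hm; apply: indexed_impl => i it [itr [/bR h1 h2]].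
    apply/(red_match _ _ _ _ rin itr); exists (ka i); split=> //.
    by move=> j lt_j jM; apply/eqP; rewrite -cR; apply: h2.
  exists nu' => //; apply/indexed_map; have := indexed_and inr hm'.
  apply: indexed_impl => i it [itr]; have [AL BL] := rok _ rin _ itr.
  case/(green_match _ _ _ _ AL BL)=> k [h1 h2 h3 h4].
  exists k; split; first exact/bG.
    by move=> j lt_j jM; rewrite cG; apply/eqP; apply: h2.
  by move=> j; rewrite !inE => /orP [] /eqP ->.
Qed.

End Refuted.
End System.

(** * Register machines as rule systems *)

Inductive instr : Type :=
| Inc of nat
| Copy of nat & nat & nat
| Jz of nat & nat
| Halt.

Definition upd (sg : nat -> nat) j v : nat -> nat := fun i => if i == j then v else sg i.

Definition step (prog : seq instr) (c : nat * (nat -> nat)) : nat * (nat -> nat) :=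
  let: (pc, sg) := c in
  match nth Halt prog pc with
  | Inc j => (pc.+1, upd sg j (sg j).+1)
  | Copy j i l => (l, upd sg j (sg i))
  | Jz j l => if sg j == 0 then (l, sg) else (pc.+1, upd sg j (sg j).-1)
  | Halt => c
  end.

Definition run prog x t : nat * (nat -> nat) :=
  iter t (step prog) (0, upd (fun=> 0) 0 x).

Definition instr_ok k m (i : instr) : bool :=
  match i with
  | Inc j => j < k
  | Copy j i l => [&& j < k, i < k & l < m]
  | Jz j l => (j < k) && (l < m)
  | Halt => true
  end.

(* A unary number is a path of [lOne]-edges ending in an [lBot]-edge, in which
   [lE]-edges stand for the empty word. *)
Definition lE := 0.
Definition lOne := 1.
Definition lBot := 2.
(** Residues modulo 3 separate states, registers and history labels; all of them lie above
    [lBot]. *)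
Definition st q := (3 * q).+3.
Definition reg j := (3 * j).+4.
Definition hist h := (3 * h).+4.+1.

Section MachineRules.
Variable k : nat.

(* Variable 0 is the time point, 1 the previous time point, [i.+4] the node of
   register [i]. The [hist] edge makes the step reversible. *)
Definition step_items pc pc' h : seq item :=
  [:: ((st pc, st pc'), (0, 0)); ((lE, lE), (0, 0)); ((lE, hist h), (0, 1))].

Definition shift pc pc' h j A B : rule :=
  (1 :: 3 :: [seq i.+4 | i <- iota 0 k & i != j],
   step_items pc pc' h ++
   [:: ((reg j, reg j), (0, 2)); ((A, B), (2, 3)); ((lE, lE), (2, 2))] ++
   [seq ((reg i, reg i), (0, i.+4)) | i <- iota 0 k & i != j]).

(** Register [m] takes over the node of register [f m]. A register outside the image of [f] is not
    mentioned, so undoing the rule never has to produce the value it lost. *)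
Definition assign pc pc' h (f : nat -> nat) (extra : seq item) : rule :=
  (1 :: [seq (f m).+4 | m <- iota 0 k],
   step_items pc pc' h ++
   [seq ((reg (f m), reg m), (0, (f m).+4)) | m <- iota 0 k] ++ extra).

(** The history label holds the address and, in its parity, the branch of a [Jz]: odd for the
    decrement. *)
Definition rules_at pc (i : instr) : seq rule :=
  match i with
  | Inc j => [:: shift pc pc.+1 (2 * pc) j lE lOne]
  | Copy j i l => [:: assign pc l (2 * pc) (fun m => if m == j then i else m) [::]]
  | Jz j l => [:: shift pc pc.+1 (2 * pc).+1 j lOne lE;
                  assign pc l (2 * pc) id [:: ((lBot, lBot), (j.+4, 3))]]
  | Halt => [::]
  end.

(** Moves an [lE]-edge behind an [A]-edge, so that tests and decrements find [lBot] or [lOne] as the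
    first edge of a number. *)
Definition commute A : rule := ([:: 0; 2], [:: ((lE, A), (0, 1)); ((A, lE), (1, 2))]).

Definition machine_rules (prog : seq instr) : seq rule :=
  [:: commute lOne; commute lBot] ++
  flatten [seq rules_at pc (nth Halt prog pc) | pc <- iota 0 (size prog)].

Fixpoint chain x : seq fact :=
  if x is x'.+1 then (lOne, (x'.+2, x'.+1)) :: chain x' else [::].

Definition base_facts : seq fact :=
  [:: (st 0, (0, 0)); (lE, (0, 0)); (lBot, (1, 1)); (lE, (1, 1))] ++
  [seq (reg j, (0, 1)) | j <- iota 1 k.-1].

(** Variable 0 is the first time point and [v.+1] the number [v]. An [lE]-loop is supplied at each
    node to which a register points. *)
Definition start_facts x : seq fact :=
  [:: (reg 0, (0, x.+1)); (lE, (x.+1, x.+1))] ++ chain x ++ base_facts.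

(** With [m] the program length, this exceeds [st m.+1], [hist (2 * m).-1] and [reg k.-1]. *)
Definition num_labels (prog : seq instr) : nat := 3 * (3 * size prog + k + 4).

(* The machine accepts at address [size prog] and rejects at [(size prog).+1]. *)
Definition machine_instance prog x : instance :=
  system (num_labels prog) (st (size prog)) (start_facts x) (machine_rules prog).

End MachineRules.

Section AllIn.
Variables (T : eqType) (Q : T -> Prop).
Definition all_in (s : seq T) : Prop := forall x, x \in s -> Q x.

Lemma all_in_cons x s : all_in (x :: s) <-> Q x /\ all_in s.
Proof.
split=> [h|[Qx h] y]; last by rewrite inE => /orP [/eqP ->|/h].
by split=> [|y ys]; apply: h; rewrite inE ?eqxx ?ys ?orbT.
Qed.

Lemma all_in_cat s s' : all_in (s ++ s') <-> all_in s /\ all_in s'.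
Proof.
split=> [h|[h h'] y]; last by rewrite mem_cat => /orP [/h|/h'].
by split=> y ys; apply: h; rewrite mem_cat ys ?orbT.
Qed.

Lemma all_in_nil : all_in [::].
Proof. by []. Qed.
End AllIn.

Lemma all_in_map (T U : eqType) (f : T -> U) (Q : U -> Prop) s :
  all_in Q (map f s) <-> all_in (fun x => Q (f x)) s.
Proof.
split=> [h x xs|h y /mapP [x /h ? ->] //]; by apply: h; apply: map_f.
Qed.

Section Machine.
Variables (k : nat) (prog : seq instr).
Local Notation m := (size prog).
Hypothesis k_gt0 : 0 < k.
Hypothesis m_gt0 : 0 < m.
Hypothesis prog_ok : all (instr_ok k m.+2) prog.
Local Notation L := (num_labels k prog).

Lemma nth_ok pc : pc < m -> instr_ok k m.+2 (nth Halt prog pc).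
Proof. by move/(all_nthP Halt): prog_ok; apply. Qed.

Lemma machine_rules_ind (P : rule -> Prop) :
  P (commute lOne) -> P (commute lBot) ->
  (forall pc j, pc < m -> nth Halt prog pc = Inc j -> j < k ->
     P (shift k pc pc.+1 (2 * pc) j lE lOne)) ->
  (forall pc j i l, pc < m -> nth Halt prog pc = Copy j i l -> j < k -> i < k -> l < m.+2 ->
     P (assign k pc l (2 * pc) (fun m => if m == j then i else m) [::])) ->
  (forall pc j l, pc < m -> nth Halt prog pc = Jz j l -> j < k -> l < m.+2 ->
     P (shift k pc pc.+1 (2 * pc).+1 j lOne lE) /\
     P (assign k pc l (2 * pc) id [:: ((lBot, lBot), (j.+4, 3))])) ->
  forall r, r \in machine_rules k prog -> P r.
Proof.
move=> c1 c2 hI hC hJ r; rewrite !inE => /or3P [/eqP -> //|/eqP -> //|].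
case/flattenP=> s /mapP [pc]; rewrite mem_iota /= add0n => lt_pc ->.
have := nth_ok lt_pc; case E: nth => [j|j i l|j l|] //=.
- by move=> jk; rewrite inE => /eqP ->; apply: hI.
- by case/and3P=> jk ik lm; rewrite inE => /eqP ->; apply: hC.
- by case/andP=> jk lm; have [h1 h2] := hJ _ _ _ lt_pc E jk lm; rewrite !inE => /orP [] /eqP ->.
Qed.

Lemma rule_okI r : all (fun it : item => (it.1.1 < L) && (it.1.2 < L)) r.2 ->
  (forall v, v \in r.1 -> exists2 it : item, it \in r.2 & it.2.2 = v) -> rule_ok L r.
Proof.
move=> h h'; apply/andP; split=> //; apply/allP => v /h' [it its <-] /=.
apply/flattenP; exists [:: it.2.1; it.2.2]; last by rewrite !inE eqxx orbT.
by apply: (map_f (fun it : item => [:: it.2.1; it.2.2])).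
Qed.

Lemma shift_ok pc pc' h j A B : pc < m.+2 -> pc' < m.+2 -> h < 2 * m -> j < k ->
  A < 3 -> B < 3 -> rule_ok L (shift k pc pc' h j A B).
Proof.
move=> h1 h2 h3 h4 h5 h6; apply: rule_okI.
  rewrite /= all_map /num_labels /st /reg /hist /lE.
  do 6! [apply/andP; split; first by lia].
  apply/allP => i; rewrite mem_filter mem_iota /= /reg => hi; lia.
move=> v; rewrite !inE => /or3P [/eqP ->|/eqP ->|/mapP [i hi ->]].
- by exists ((lE, hist h), (0, 1)); rewrite // !inE eqxx ?orbT.
- by exists ((A, B), (2, 3)); rewrite // !inE eqxx ?orbT.
exists ((reg i, reg i), (0, i.+4)) => //.
rewrite mem_cat; apply/orP; right; rewrite mem_cat; apply/orP; right.
by apply/mapP; exists i.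
Qed.

Lemma assign_ok pc pc' h f extra : pc < m.+2 -> pc' < m.+2 -> h < 2 * m ->
  (forall i, i < k -> f i < k) -> all (fun it : item => (it.1.1 < 3) && (it.1.2 < 3)) extra ->
  rule_ok L (assign k pc pc' h f extra).
Proof.
move=> h1 h2 h3 h4 h5; apply: rule_okI.
  rewrite /= all_cat all_map /num_labels /st /reg /hist /lE.
  do 3! [apply/andP; split; first by lia].
  apply/andP; split.
    apply/allP => i; rewrite mem_iota /= /reg => hi; have := h4 i; lia.
  by apply/allP => it /(allP h5) /andP [a1 a2]; apply/andP; split;
    [apply: leq_trans a1 _|apply: leq_trans a2 _]; lia.
move=> v; rewrite !inE => /orP [/eqP ->|/mapP [i hi ->]].
  by exists ((lE, hist h), (0, 1)); rewrite // !inE eqxx ?orbT.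
exists ((reg (f i), reg i), (0, (f i).+4)) => //.
rewrite mem_cat; apply/orP; right; rewrite mem_cat; apply/orP; left.
by apply/mapP; exists i.
Qed.

Lemma commute_ok A : A < 3 -> rule_ok L (commute A).
Proof. by move=> h; rewrite /rule_ok /= /num_labels /lE !andbT; lia. Qed.

Lemma machine_rules_ok : all (rule_ok L) (machine_rules k prog).
Proof.
apply/allP; apply: machine_rules_ind; try exact: commute_ok.
- by move=> *; apply: shift_ok => //; lia.
- by move=> pc j i l *; apply: assign_ok => //; try lia; move=> n nk /=; case: ifP.
- by move=> *; split; [apply: shift_ok|apply: assign_ok] => //; lia.
Qed.

Lemma chain_in x f : f \in chain x -> exists2 i, i < x & f = (lOne, (i.+2, i.+1)).
Proof.
elim: x => //= x IH; rewrite inE => /orP [/eqP ->|/IH [i ix ->]]; first by exists x.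
by exists i => //; apply: ltnW.
Qed.

Lemma start_facts_ok x :
  all (fun f : fact => (f.1 < L) && (f.1 != st m)) (start_facts k x).
Proof.
have hb : all (fun f : fact => (f.1 < L) && (f.1 != st m)) (base_facts k).
  rewrite /= all_map /num_labels /st /lE /lBot; do 4! [apply/andP; split; first by lia].
  by apply/allP => j; rewrite mem_iota /= /reg; lia.
rewrite /start_facts all_cat all_cat hb andbT; apply/andP; split.
  by rewrite /= /num_labels /st /reg /lE; lia.
by apply/allP => f /chain_in [i _ ->]; rewrite /= /num_labels /st /lOne; lia.
Qed.

(** * Following the run inside an arbitrary model *)

Section Forward.
Variable F : nat -> nat -> nat -> Prop.
Hypothesis F_rules : forall r, r \in machine_rules k prog -> forward F r.

(** [F] may contain many further facts, and a node may represent several numbers; it is enough that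
    it represents the right one. *)
Inductive represents : nat -> nat -> Prop :=
| rep_bot p s : F lBot p s -> represents p 0
| rep_one p s v : F lOne p s -> represents s v -> represents p v.+1
| rep_e p s v : F lE p s -> represents s v -> represents p v.

Lemma commuteP A p s s' : A \in [:: lOne; lBot] -> F lE p s -> F A s s' ->
  exists2 s0, F A p s0 & F lE s0 s'.
Proof.
move=> hA h1 h2; have hr : commute A \in machine_rules k prog.
  by move: hA; rewrite !inE => /orP [] /eqP ->; rewrite eqxx ?orbT.
pose nu v := nth s' [:: p; s] v.
have [|nu' hfv h] := F_rules hr (nu := nu).
  by move=> it; rewrite !inE => /orP [] /eqP ->.
exists (nu' 1).
  by have := h _ (mem_head _ _); rewrite /= -(hfv 0).
have := h ((A, lE), (1, 2)); rewrite /= -(hfv 2) //; apply.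
by rewrite !inE eqxx orbT.
Qed.

Lemma represents0 p : represents p 0 -> exists s, F lBot p s.
Proof.
move E: 0 => v H; elim: H E => {p v} // [p s h _|p s v h _ IH /IH [s' h']]; first by exists s.
by have [s0 h0 _] := commuteP (isT : lBot \in [:: lOne; lBot]) h h'; exists s0.
Qed.

Lemma representsS p v : represents p v.+1 -> exists2 s, F lOne p s & represents s v.
Proof.
move E: v.+1 => w H; elim: H v E => {p w} // [p s w h hr _ v [->]|p s w h _ IH v /IH [s' h' hr]].
  by exists s.
have [s0 h0 h1] := commuteP (isT : lOne \in [:: lOne; lBot]) h h'; exists s0 => //.
exact: rep_e h1 hr.
Qed.

Definition simulates (c : nat * (nat -> nat)) t : Prop :=
  [/\ F (st c.1) t t, F lE t t & exists P : nat -> nat, forall j, j < k ->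
    [/\ F (reg j) t (P j), F lE (P j) (P j) & represents (P j) (c.2 j)]].

Definition env t p s (P : nat -> nat) v :=
  match v with 0 | 1 => t | 2 => p | 3 => s | v'.+4 => P v' end.

Lemma shift_step pc pc' h j A B t P s :
  shift k pc pc' h j A B \in machine_rules k prog -> j < k ->
  F (st pc) t t -> F lE t t ->
  (forall i, i < k -> F (reg i) t (P i) /\ F lE (P i) (P i)) -> F A (P j) s ->
  exists t' p', [/\ F (st pc') t' t', F lE t' t', F B p' s & forall i, i < k ->
    let q := if i == j then p' else P i in F (reg i) t' q /\ F lE q q].
Proof.
move=> hr jk h1 h2 h3 h4; have [hj1 hj2] := h3 _ jk.
have [|nu' hfv] := F_rules hr (nu := env t (P j) s P).
  rewrite /lhs; do !(apply/all_in_cons; split=> //).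
  apply/all_in_map => i; rewrite mem_filter mem_iota => /andP [_ ik] /=.
  by have [] := h3 i ik.
case/all_in_cons=> /= g1 /all_in_cons [/= g2] /all_in_cons [_].
case/all_in_cons=> /= g3 /all_in_cons [/= g4] /all_in_cons [/= g5] /all_in_map g6.
exists (nu' 0), (nu' 2); split=> //; first by have := hfv 3; rewrite !inE /= => ->.
move=> i ik /=; case: eqP => [-> //|/eqP ij].
have iin : i \in [seq i <- iota 0 k | i != j] by rewrite mem_filter ij mem_iota.
have [_ ?] := h3 i ik; split=> //; have := g6 i iin; rewrite /= -(hfv i.+4) //.
by rewrite !inE; apply/orP; right; apply: map_f.
Qed.

Lemma assign_step pc pc' h f extra t P s :
  assign k pc pc' h f extra \in machine_rules k prog -> (forall i, i < k -> f i < k) ->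
  F (st pc) t t -> F lE t t ->
  (forall i, i < k -> F (reg i) t (P i) /\ F lE (P i) (P i)) ->
  all_in (fun it : item => F it.1.1 (env t t s P it.2.1) (env t t s P it.2.2)) extra ->
  exists t', [/\ F (st pc') t' t', F lE t' t' & forall i, i < k -> F (reg i) t' (P (f i))].
Proof.
move=> hr hf h1 h2 h3 h4.
have [|nu' hfv] := F_rules hr (nu := env t t s P).
  rewrite /lhs; do !(apply/all_in_cons; split=> //).
  apply/all_in_cat; split=> //.
  apply/all_in_map => i; rewrite mem_iota => /andP [_ ik] /=.
  by have [] := h3 _ (hf i ik).
case/all_in_cons=> /= g1 /all_in_cons [/= g2] /all_in_cons [_].
case/all_in_cat=> /all_in_map g3 _; exists (nu' 0); split=> // i ik.
have iin : i \in iota 0 k by rewrite mem_iota.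
have := g3 i iin; rewrite /= -(hfv (f i).+4) //.
by rewrite inE; apply: (map_f (fun i => (f i).+4)).
Qed.

Lemma rules_at_in pc r : pc < m -> r \in rules_at k pc (nth Halt prog pc) ->
  r \in machine_rules k prog.
Proof.
move=> lt_pc h; rewrite mem_cat; apply/orP; right; apply/flattenP.
exists (rules_at k pc (nth Halt prog pc)) => //.
by apply: (map_f (fun pc => rules_at k pc (nth Halt prog pc))); rewrite mem_iota.
Qed.

Lemma simulates_step c t : simulates c t -> exists t', simulates (step prog c) t'.
Proof.
case: c => pc sg [/= h1 h2 [P hP]].
have [lt_pc|ge_pc] := ltnP pc m; last first.
  by rewrite nth_default //; exists t; split=> //; exists P.
have hr := rules_at_in lt_pc; have := nth_ok lt_pc.
have h3 i : i < k -> F (reg i) t (P i) /\ F lE (P i) (P i) by case/hP.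
case E: nth hr => [j|j i l|j l|] hr /=.
- move=> jk; have [_ hj hrep] := hP _ jk.
  have [t' [p' [g1 g2 g3 g4]]] := shift_step (hr _ (mem_head _ _)) jk h1 h2 h3 hj.
  exists t'; split=> //; exists (fun i => if i == j then p' else P i) => i ik.
  have [g5 g6] := g4 i ik; split=> //; rewrite /= /upd; case: eqP => // _.
    exact: rep_one g3 hrep.
  by have [] := hP i ik.
- case/and3P=> jk ik lm.
  have hf n : n < k -> (if n == j then i else n) < k by case: eqP.
  have [t' [g1 g2 g3]] := assign_step (s := t) (hr _ (mem_head _ _)) hf h1 h2 h3 (@all_in_nil _ _).
  exists t'; split=> //; exists (fun n => P (if n == j then i else n)) => n nk.
  have [_ g4 g5] := hP _ (hf n nk); split=> //; first exact: g3.
  by move: g5; rewrite /= /upd; case: eqP.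
- case/andP=> jk lm; have [_ hj hrep] := hP _ jk.
  case: eqP => [sg0|/eqP sgn0].
    rewrite sg0 in hrep; have [s hs] := represents0 hrep.
    have hr2 := hr _ (mem_last _ _).
    have [//||t' [g1 g2 g3]] := assign_step (s := s) hr2 _ h1 h2 h3.
      by apply/all_in_cons; split.
    exists t'; split=> //; exists P => i ik; have [_ ? ?] := hP i ik; split=> //.
    exact: g3.
  have e : sg j = (sg j).-1.+1 by rewrite prednK // lt0n.
  rewrite e in hrep; have [s hs hrep'] := representsS hrep.
  have [t' [p' [g1 g2 g3 g4]]] := shift_step (hr _ (mem_head _ _)) jk h1 h2 h3 hs.
  exists t'; split=> //; exists (fun i => if i == j then p' else P i) => i ik.
  have [g5 g6] := g4 i ik; split=> //; rewrite /= /upd; case: eqP => // _.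
    exact: rep_e g3 hrep'.
  by have [] := hP i ik.
- by move=> _; exists t; split=> //; exists P.
Qed.

Lemma simulates_start x nu : holds F nu (start_facts k x) ->
  simulates (0, upd (fun=> 0) 0 x) (nu 0).
Proof.
case/all_in_cons=> /= h1 /all_in_cons [/= h2] /all_in_cat [hc] /all_in_cat [].
case/all_in_cons=> /= h3 /all_in_cons [/= h4] /all_in_cons [/= h5] /all_in_cons [/= h6 _].
move/all_in_map=> h7; split=> //; exists (fun j => if j == 0 then nu x.+1 else nu 1) => j jk.
have rep0 : represents (nu 1) 0 by apply: rep_bot h5.
rewrite /= /upd; case: eqP => [->|/eqP j0]; last first.
  by split=> //; apply: h7; rewrite mem_iota; lia.
split=> //; elim: x {h1 h2} hc => [_|x IH] //= /all_in_cons [/= h8 /IH].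
exact: rep_one.
Qed.

End Forward.

Theorem machine_accepts x t :
  (run prog x t).1 = m -> FD (machine_instance k prog x).
Proof.
move=> hacc; apply: system_determined.
- by rewrite /num_labels /st; lia.
- by apply: sub_all (start_facts_ok x) => f /andP [].
- exact: machine_rules_ok.
move=> F [nu hs] hF.
have [u [hu _ _]] : exists u, simulates F (run prog x t) u.
  elim: t {hacc} => [|t [u IH]]; first by exists (nu 0); apply: simulates_start.
  by have [u' h] := simulates_step hF IH; exists u'.
by exists u; rewrite -hacc.
Qed.

(** * The trace of a rejecting run as a model *)

Section Backward.
Variables (x T : nat).
Local Notation pc t := (run prog x t).1.
Local Notation sg t := (run prog x t).2.
Hypothesis halted : pc T = m.+1.

(** Nodes 0 and 1 are reserved for the special spiders of the counterexample. Registers stay below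
    or at [x + T] up to time [T], so [tau] starts right after the last number node. *)
Definition num v := v.+2.
Definition tau t := x + T + t + 3.
Definition step_branch t : bool :=
  if nth Halt prog (pc t) is Jz j _ then sg t j != 0 else false.
Definition step_code t : nat := 2 * pc t + step_branch t.

(** Here [lE] is the identity and each number has a single node, which makes the commutation rules
    trivial. *)
Inductive trace : nat -> nat -> nat -> Prop :=
| trE y : 1 < y < tau T.+1 -> trace lE y y
| trOne v : v < x + T -> trace lOne (num v.+1) (num v)
| trBot : trace lBot (num 0) (num 0)
| trSt t : t <= T -> trace (st (pc t)) (tau t) (tau t)
| trReg t j : t <= T -> j < k -> trace (reg j) (tau t) (num (sg t j))
| trHist t : t < T -> trace (hist (step_code t)) (tau t.+1) (tau t).

Lemma trE_inv a b : trace lE a b -> a = b /\ 1 < b < tau T.+1.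
Proof. by move E: lE => l H; case: H E. Qed.

Lemma trOne_inv a b : trace lOne a b -> exists2 v, v < x + T & a = num v.+1 /\ b = num v.
Proof. by move E: lOne => l H; case: H E => // v vT _; exists v. Qed.

Lemma trBot_inv a b : trace lBot a b -> a = num 0 /\ b = num 0.
Proof. by move E: lBot => l H; case: H E. Qed.

Lemma trSt_inv q a b : trace (st q) a b ->
  exists2 t, t <= T & [/\ q = pc t, a = tau t & b = tau t].
Proof.
move E: (st q) => l H; case: H E => // [t tT|t j _ _|t _]; rewrite /st ?/reg ?/hist => e.
- by exists t => //; split=> //; move: (pc t) e => c; lia.
- by lia.
- by move: (step_code t) e => c; lia.
Qed.

Lemma trReg_inv j a b : trace (reg j) a b ->
  exists2 t, t <= T & [/\ j < k, a = tau t & b = num (sg t j)].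
Proof.
move E: (reg j) => l H; case: H E => // [t _|t i tT ik|t _]; rewrite /reg ?/st ?/hist => e.
- by move: (pc t) e => c; lia.
- by have -> : j = i; [lia | exists t].
- by move: (step_code t) e => c; lia.
Qed.

Lemma trHist_inv h a b : trace (hist h) a b ->
  exists2 t, t < T & [/\ h = step_code t, a = tau t.+1 & b = tau t].
Proof.
move E: (hist h) => l H; case: H E => // [t _|t i _ _|t tT]; rewrite /hist ?/st ?/reg => e.
- by move: (pc t) e => c; lia.
- by lia.
- by exists t => //; split=> //; move: (step_code t) e => c; lia.
Qed.

Lemma runS t : run prog x t.+1 = step prog (run prog x t).
Proof. by []. Qed.

Lemma sg_bound t j : sg t j <= x + t.
Proof.
elim: t j => [|t IH] j; first by rewrite /= /upd; case: eqP; lia.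
rewrite runS; case: (run prog x t) IH => p s /= IH; case: nth => [i|i i' l|i l|] /=; rewrite /upd.
- by case: eqP => _; have := IH i; have := IH j; lia.
- by case: eqP => _; have := IH i'; have := IH j; lia.
- by case: ifP => _ /=; [|case: eqP => _]; have := IH i; have := IH j; lia.
- by have := IH j; lia.
Qed.

Lemma pc_stuck q t t' : m <= q -> pc t = q -> t <= t' -> pc t' = q.
Proof.
move=> mq et; elim: t' => [|t' IH]; first by rewrite leqn0 => /eqP <-.
rewrite leq_eqVlt => /orP [/eqP <- //|/IH e].
by rewrite runS; case: (run prog x t') e mq => p s /= -> mq; rewrite nth_default.
Qed.

(** Halting enters here: rules fire at addresses below [m] only, so the time point they ask for is
    still in the trace. *)
Lemma pc_lt t : t <= T -> pc t < m -> t < T.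
Proof.
rewrite leq_eqVlt => /orP [/eqP -> |//]; rewrite halted; lia.
Qed.

Lemma trace_nodes A a b : trace A a b -> 1 < a < tau T.+1 /\ 1 < b < tau T.+1.
Proof.
case=> [y|v||t|t j|t]; rewrite /tau /num; try lia.
by move=> tT _; have := sg_bound t j; lia.
Qed.

Lemma num_node t j : t <= T -> 1 < num (sg t j) < tau T.+1.
Proof. by rewrite /num /tau; have := sg_bound t j; lia. Qed.

Lemma tau_node t : t <= T -> 1 < tau t < tau T.+1.
Proof. by rewrite /tau; lia. Qed.

Lemma tau_inj t t' : tau t = tau t' -> t = t'.
Proof. by rewrite /tau; lia. Qed.

(** A match determines its time: forward through the state label, backward through the history edge,
    whose code fixes instruction and branch. Each hypothesis then concerns a single machine step. *)
Lemma shift_rule pc0 pc' h j A B : j < k -> pc0 < m ->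
  (forall t s, t < T -> pc t = pc0 -> trace A (num (sg t j)) s ->
     [/\ step_code t = h, pc t.+1 = pc', (forall i, i != j -> sg t.+1 i = sg t i)
       & trace B (num (sg t.+1 j)) s]) ->
  (forall t s, t < T -> step_code t = h -> trace B (num (sg t.+1 j)) s ->
     [/\ pc t = pc0, (forall i, i != j -> sg t.+1 i = sg t i)
       & trace A (num (sg t j)) s]) ->
  forward trace (shift k pc0 pc' h j A B) /\ backward trace (shift k pc0 pc' h j A B).
Proof.
move=> jk pcm H1 H2; split=> nu.
  case/all_in_cons=> /= /trSt_inv [t tT [epc e0 _]] /all_in_cons [_].
  case/all_in_cons=> /= /trE_inv [e1 _] /all_in_cons [/= /trReg_inv [t1 _ [_ et e2]]].
  have {}et : t1 = t by apply: tau_inj; rewrite -et.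
  subst t1; case/all_in_cons=> /= hA /all_in_cons [_] /all_in_map hr.
  have lt_t : t < T by apply: pc_lt => //; rewrite -epc.
  rewrite e2 in hA; have [ec epc' eo hB] := H1 _ _ lt_t (esym epc) hA.
  (* Only the existential variables move: 0 to the next time point, 2 to the node of the new
     value. *)
  exists (fun v => if v == 0 then tau t.+1 else if v == 2 then num (sg t.+1 j) else nu v).
    move=> v; rewrite !inE => /or3P [/eqP ->|/eqP ->|/mapP [i _ ->]] //.
  rewrite /rhs.
  apply/all_in_cons; split; first by rewrite /=; rewrite -epc'; apply: trSt.
  apply/all_in_cons; split; first exact: (trE (tau_node _)).
  apply/all_in_cons; split; first by rewrite /=; rewrite -e1 e0 -ec; apply: trHist.
  apply/all_in_cons; split; first exact: trReg.
  apply/all_in_cons; split; first by [].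
  apply/all_in_cons; split; first exact: (trE (num_node _ _)).
  apply/all_in_map => i iin /=; have /= /trReg_inv [t1 _ [ik et ->]] := hr i iin.
  have {}et : t1 = t by apply: tau_inj; rewrite -et.
  move: iin; rewrite et mem_filter => /andP [ij _]; rewrite -eo //; exact: trReg.
case/all_in_cons=> _ /all_in_cons [_].
case/all_in_cons=> /= /trHist_inv [t tT [ec e0 e1]] /all_in_cons [/= /trReg_inv [t1 _ [_ et e2]]].
have {}et : t1 = t.+1 by apply: tau_inj; rewrite -et.
subst t1; case/all_in_cons=> /= hB /all_in_cons [_] /all_in_map hr.
rewrite e2 in hB; have [epc eo hA] := H2 _ _ tT (esym ec) hB.
exists (fun v => if v == 0 then tau t else if v == 2 then num (sg t j) else nu v).
  move=> v; rewrite !inE => /or3P [/eqP ->|/eqP ->|/mapP [i _ ->]] //.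
have tT' : t <= T by apply: ltnW.
rewrite /lhs.
apply/all_in_cons; split; first by rewrite /=; rewrite -epc; apply: trSt.
apply/all_in_cons; split; first exact: (trE (tau_node _)).
apply/all_in_cons; split; first by rewrite /=; rewrite e1; apply/trE/tau_node.
apply/all_in_cons; split; first exact: trReg.
apply/all_in_cons; split; first by [].
apply/all_in_cons; split; first exact: (trE (num_node _ _)).
apply/all_in_map => i iin /=; have /= /trReg_inv [t1 _ [ik et ->]] := hr i iin.
have {}et : t1 = t.+1 by apply: tau_inj; rewrite -et.
move: iin; rewrite et mem_filter => /andP [ij _]; rewrite eo //; exact: trReg.
Qed.

Lemma assign_rule pc0 pc' h f extra : pc0 < m -> (forall i, i < k -> f i < k) ->
  (forall it : item, it \in extra -> [/\ it.1.1 = it.1.2, it.2.1 != 0 & it.2.2 != 0]) ->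
  (forall t nu, t < T -> pc t = pc0 -> (forall i, i < k -> nu (f i).+4 = num (sg t (f i))) ->
     all_in (fun it : item => trace it.1.1 (nu it.2.1) (nu it.2.2)) extra ->
     [/\ step_code t = h, pc t.+1 = pc' & forall i, i < k -> sg t.+1 i = sg t (f i)]) ->
  (forall t, t < T -> step_code t = h ->
     pc t = pc0 /\ forall i, i < k -> sg t.+1 i = sg t (f i)) ->
  forward trace (assign k pc0 pc' h f extra) /\ backward trace (assign k pc0 pc' h f extra).
Proof.
move=> pcm hf hx H1 H2; split=> nu.
  case/all_in_cons=> /= /trSt_inv [t tT [epc e0 _]] /all_in_cons [_].
  case/all_in_cons=> /= /trE_inv [e1 _] /all_in_cat [/all_in_map hr he].
  have lt_t : t < T by apply: pc_lt => //; rewrite -epc.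
  have hn i : i < k -> nu (f i).+4 = num (sg t (f i)).
    move=> ik; have iin : i \in iota 0 k by rewrite mem_iota.
    have /= /trReg_inv [t1 _ [_ et ->]] := hr i iin.
    by have -> : t1 = t by apply: tau_inj; rewrite -et.
  have [ec epc' es] := H1 _ _ lt_t (esym epc) hn he.
  exists (fun v => if v == 0 then tau t.+1 else nu v).
    by move=> v; rewrite !inE => /orP [/eqP ->|/mapP [i _ ->]].
  rewrite /rhs.
  apply/all_in_cons; split; first by rewrite /=; rewrite -epc'; apply: trSt.
  apply/all_in_cons; split; first exact: (trE (tau_node _)).
  apply/all_in_cons; split; first by rewrite /=; rewrite -e1 e0 -ec; apply: trHist.
  apply/all_in_cat; split.
    apply/all_in_map => i; rewrite mem_iota => /andP [_ ik] /=.
    by rewrite hn // -es //; apply: trReg.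
  move=> it ite; have [e /negbTE -> /negbTE ->] := hx _ ite; rewrite -e; exact: he.
case/all_in_cons=> _ /all_in_cons [_].
case/all_in_cons=> /= /trHist_inv [t tT [ec e0 e1]] /all_in_cat [/all_in_map hr he].
have [epc es] := H2 _ tT (esym ec).
have tT' : t <= T by apply: ltnW.
exists (fun v => if v == 0 then tau t else nu v).
  by move=> v; rewrite !inE => /orP [/eqP ->|/mapP [i _ ->]].
rewrite /lhs.
apply/all_in_cons; split; first by rewrite /=; rewrite -epc; apply: trSt.
apply/all_in_cons; split; first exact: (trE (tau_node _)).
apply/all_in_cons; split; first by rewrite /=; rewrite e1; apply/trE/tau_node.
apply/all_in_cat; split.
  apply/all_in_map => i iin /=; have ik : i < k by move: iin; rewrite mem_iota.
  have /= /trReg_inv [t1 _ [_ et ->]] := hr i iin.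
  have -> : t1 = t.+1 by apply: tau_inj; rewrite -et.
  by rewrite es //; apply: trReg => //; apply: hf.
move=> it ite; have [e /negbTE -> /negbTE ->] := hx _ ite; rewrite e; exact: he.
Qed.

Lemma commute_rule A :
  (forall a b, trace A a b -> trace lE a a /\ trace lE b b) ->
  forward trace (commute A) /\ backward trace (commute A).
Proof.
move=> hA; split=> nu.
  case/all_in_cons=> /= /trE_inv [e _] /all_in_cons [/= h _]; have [_ hE] := hA _ _ h.
  exists (fun v => if v == 1 then nu 2 else nu v).
    by move=> v; rewrite !inE => /orP [] /eqP ->.
  apply/all_in_cons; split; first by rewrite /= e.
  exact/all_in_cons.
case/all_in_cons=> /= h /all_in_cons [/= /trE_inv [e _] _]; have [hE _] := hA _ _ h.
exists (fun v => if v == 1 then nu 0 else nu v).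
  by move=> v; rewrite !inE => /orP [] /eqP ->.
apply/all_in_cons; split; first by [].
by apply/all_in_cons; split=> //=; rewrite -e.
Qed.

Lemma trace_loops A a b : trace A a b -> trace lE a a /\ trace lE b b.
Proof. by move/trace_nodes=> [ha hb]; split; apply: trE. Qed.

Lemma step_codeE t q (b : bool) : step_code t = 2 * q + b ->
  pc t = q /\ step_branch t = b.
Proof.
have eq_bits p (c : bool) : 2 * p + c = 2 * q + b -> p = q /\ c = b.
  by case: c b => [] [] /= h; split=> //; lia.
exact: eq_bits.
Qed.

Lemma trace_rules r : r \in machine_rules k prog -> forward trace r /\ backward trace r.
Proof.
move: r; apply: machine_rules_ind; try exact/commute_rule/trace_loops.
- move=> p j pm E jk; apply: shift_rule => // t s tT.
    move=> ep /trE_inv [<- _]; have hb := sg_bound t j.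
    rewrite /step_code /step_branch runS; move: ep hb; case: (run prog x t) => p' s' /= -> hb.
    rewrite E addn0 /= /upd eqxx; split=> // [i /negbTE -> //|].
    by apply: trOne; lia.
  move=> hc; have [ep _] := @step_codeE t p false ltac:(by rewrite hc; lia).
  have hn := num_node j (ltnW tT).
  rewrite runS; move: ep hn; case: (run prog x t) => p' s' /= -> hn.
  rewrite E /= /upd eqxx => /trOne_inv [v _ [e ->]]; split=> // [i /negbTE -> //|].
  have -> : num v = num (s' j) by move: e; rewrite /num; lia.
  exact: trE.
- move=> p j i l pm E jk ik lm; apply: assign_rule => //.
  + by move=> n nk; case: eqP.
  + move=> t nu tT ep _ _; rewrite /step_code /step_branch runS; move: ep.
    case: (run prog x t) => p' s' /= ->; rewrite E addn0 /= /upd; split=> // n nk.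
    by case: eqP.
  + move=> t tT hc; have [ep _] := @step_codeE t p false ltac:(by rewrite hc; lia).
    rewrite runS; move: ep; case: (run prog x t) => p' s' /= ->; rewrite E /= /upd.
    by split=> // n nk; case: eqP.
- move=> p j l pm E jk lm; split.
    apply: shift_rule => // t s tT.
      move=> ep /trOne_inv [v vT [e ->]].
      have hn := num_node j tT; rewrite runS /step_code /step_branch in hn *.
      move: ep e hn; case: (run prog x t) => p' s' /= ->.
      rewrite E /= => e; have sj : s' j = v.+1 by move: e; rewrite /num; lia.
      rewrite sj /= /upd eqxx => hn; split=> // [||]; first by lia.
        by move=> i /negbTE ->.
      exact: trE.
    move=> hc; have [ep ec] := @step_codeE t p true ltac:(by rewrite hc; lia).
    have hb := sg_bound t j.
    rewrite runS; move: ep ec hb; rewrite /step_branch; case: (run prog x t) => p' s' /= ->.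
    rewrite E /= => sj hb; rewrite (negbTE sj) /= /upd eqxx => /trE_inv [<- _].
    split=> // [i /negbTE -> //|]; rewrite -{1}(prednK (n := s' j)) ?lt0n //.
    by apply: trOne; lia.
  apply: assign_rule => //.
  + by move=> it; rewrite inE => /eqP ->.
  + move=> t nu tT ep hn /all_in_cons [/= /trBot_inv [e _] _].
    rewrite hn // in e; rewrite /step_code /step_branch; move: ep e; case: (run prog x t) => p' s' /= ->.
    rewrite E /= => e; have -> : s' j = 0 by move: e; rewrite /num; lia.
    by rewrite /= addn0.
  + move=> t tT hc; have [ep ec] := @step_codeE t p false ltac:(by rewrite hc; lia).
    rewrite runS; move: ep ec; rewrite /step_branch; case: (run prog x t) => p' s' /= ->; rewrite E /=.
    by move/negbFE=> ->.
Qed.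

Lemma rule_connected_shift pc0 pc' h j A B : connected (shift k pc0 pc' h j A B).
Proof.
move=> kind hk; suff h0 : forall it, it \in (shift k pc0 pc' h j A B).2 -> kind it.2.1 = kind 0.
  by move=> it it' /h0 -> /h0 ->.
case/all_in_cons: hk => _ /all_in_cons [_] /all_in_cons [_] /all_in_cons [/= e _].
do 6! [apply/all_in_cons; split=> //].
by apply/all_in_map.
Qed.

Lemma rule_connected_assign pc0 pc' h f extra :
  (forall it : item, it \in extra -> exists2 i, i < k & it.2.1 = (f i).+4) ->
  connected (assign k pc0 pc' h f extra).
Proof.
move=> hx kind hk; suff h0 : forall it, it \in (assign k pc0 pc' h f extra).2 -> kind it.2.1 = kind 0.
  by move=> it it' /h0 -> /h0 ->.
case/all_in_cons: hk => _ /all_in_cons [_] /all_in_cons [_] /all_in_cat [/all_in_map h1 _].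
do 3! [apply/all_in_cons; split=> //].
apply/all_in_cat; split; first by apply/all_in_map.
move=> it /hx [i ik ->]; have iin : i \in iota 0 k by rewrite mem_iota.
by rewrite -(h1 _ iin).
Qed.

Lemma rule_connected_commute A : connected (commute A).
Proof.
move=> kind /all_in_cons [/= h0 _] it it'.
by rewrite !inE => /orP [] /eqP -> /orP [] /eqP -> /=.
Qed.

Theorem machine_rejects : ~ FD (machine_instance k prog x).
Proof.
apply: (@system_not_determined _ _ _ _ _ (tau T.+1) trace).
- by rewrite /num_labels /st; lia.
- exact: machine_rules_ok.
- apply: machine_rules_ind; try exact: rule_connected_commute.
  + by move=> *; apply: rule_connected_shift.
  + by move=> *; apply: rule_connected_assign.
  + move=> p j l *; split; first exact: rule_connected_shift.
    by apply: rule_connected_assign => it; rewrite inE => /eqP ->; exists j.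
- have lEb : lE != st m by rewrite /lE /st; lia.
  apply: machine_rules_ind.
  + by exists ((lE, lOne), (0, 1)) => //; split=> //; rewrite /= /lOne /st; lia.
  + by exists ((lE, lBot), (0, 1)) => //; split=> //; rewrite /= /lBot /st; lia.
  + by move=> *; exists ((lE, lE), (0, 0)) => //; rewrite !inE eqxx ?orbT.
  + by move=> *; exists ((lE, lE), (0, 0)) => //; rewrite !inE eqxx ?orbT.
  + by move=> *; split; exists ((lE, lE), (0, 0)) => //; rewrite !inE eqxx ?orbT.
- exact: start_facts_ok.
- by rewrite /tau; lia.
- exact: trace_nodes.
- move=> a b /trSt_inv [t tT [e _ _]].
  (* The accepting address is absorbing, so a run that ends at [m.+1] never visits it. *)
  have := pc_stuck (leqnn m) (esym e) tT; rewrite halted; lia.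
- exists (fun v => if v is v'.+1 then num v' else tau 0).
  apply/all_in_cons; split; first exact: (@trReg 0 0).
  apply/all_in_cons; split; first by apply: trE; rewrite /num /tau; lia.
  apply/all_in_cat; split.
    by move=> f /chain_in [i ix ->] /=; apply: trOne; lia.
  apply/all_in_cons; split; first by rewrite /=; exact: (@trSt 0).
  apply/all_in_cons; split; first exact: (trE (tau_node _)).
  apply/all_in_cons; split; first by rewrite /=; exact: trBot.
  apply/all_in_cons; split; first by rewrite /=; apply: trE; rewrite /num /tau; lia.
  apply/all_in_map => j; rewrite mem_iota => /andP [j0 jk] /=.
  have -> : num 0 = num (sg 0 j) by rewrite /= /upd; case: eqP => //; lia.
  by apply: trReg => //; lia.
- exact: trace_rules.
Qed.

End Backward.
End Machine.

(** * Compiling mu-recursive functions to register machines *)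

Lemma cpair_up a c : cpair a c.+1 = (cpair a.+1 c).+1.
Proof. by rewrite /cpair addnS addSn addnS. Qed.

Lemma cpair_row a : cpair a.+1 0 = (cpair 0 a).+1.
Proof.
rewrite /cpair !addn0 add0n.
have -> : a.+1 * a.+2 = a * a.+1 + a.+1.*2 by lia.
by rewrite halfD odd_double andbF add0n doubleK; lia.
Qed.

(** Successor along the antidiagonals. Unpairing by iteration avoids square roots and is easy for a
    register machine. *)
Definition cnext (p : nat * nat) : nat * nat :=
  if p.1 is a.+1 then (a, p.2.+1) else (p.2.+1, 0).
Definition unpair n : nat * nat := iter n cnext (0, 0).

Lemma cpairK a c : unpair (cpair a c) = (a, c).
Proof.
move E: (cpair a c) => n; elim: n a c E => [|n IH] a c.
  by case: c => [|c]; [case: a => [//|a]; rewrite cpair_row|rewrite cpair_up].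
case: c => [|c].
  by case: a => [//|a]; rewrite cpair_row => -[/IH e]; rewrite /unpair iterS -/(unpair n) e.
by rewrite cpair_up => -[/IH e]; rewrite /unpair iterS -/(unpair n) e.
Qed.

Lemma unpairK n : cpair (unpair n).1 (unpair n).2 = n.
Proof.
elim: n => [//|n IH]; rewrite /unpair iterS -/(unpair n).
by case: (unpair n) IH => [[|a] c] /= <-; rewrite ?cpair_row ?cpair_up.
Qed.

Lemma cpair_inj a c a' c' : cpair a c = cpair a' c' -> a = a' /\ c = c'.
Proof. by move/(congr1 unpair); rewrite !cpairK => -[-> ->]. Qed.

(** As with [Jz], finding a register nonzero also decrements it, in [CIf] and at each turn of
    [CLoop]. *)
Inductive com : Type :=
| CInc of nat
| CCopy of nat & nat
| CSeq of com & com
| CIf of nat & com & com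
| CLoop of nat & com.

(* The assignment [upd s r (s r)] after a branch or a loop body is the effect of the
   jump [Copy r r _] with which its compiled code ends. *)
Inductive exec : com -> (nat -> nat) -> (nat -> nat) -> Prop :=
| xInc r s : exec (CInc r) s (upd s r (s r).+1)
| xCopy j i s : exec (CCopy j i) s (upd s j (s i))
| xSeq c1 c2 s s1 s2 : exec c1 s s1 -> exec c2 s1 s2 -> exec (CSeq c1 c2) s s2
| xIf0 r c1 c2 s s1 : s r = 0 -> exec c2 s s1 -> exec (CIf r c1 c2) s s1
| xIfS r c1 c2 s s1 v : s r = v.+1 -> exec c1 (upd s r v) s1 ->
    exec (CIf r c1 c2) s (upd s1 r (s1 r))
| xLoop0 r c s : s r = 0 -> exec (CLoop r c) s s
| xLoopS r c s s1 s2 v : s r = v.+1 -> exec c (upd s r v) s1 ->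
    exec (CLoop r c) (upd s1 r (s1 r)) s2 -> exec (CLoop r c) s s2.

Fixpoint csize c : nat :=
  match c with
  | CInc _ | CCopy _ _ => 1
  | CSeq c1 c2 => csize c1 + csize c2
  | CIf _ c1 c2 => (csize c1 + (csize c2).+1).+1
  | CLoop _ c => (csize c).+2
  end.

Fixpoint compile c p : seq instr :=
  match c with
  | CInc r => [:: Inc r]
  | CCopy j i => [:: Copy j i p.+1]
  | CSeq c1 c2 => compile c1 p ++ compile c2 (p + csize c1)
  | CIf r c1 c2 => Jz r (p.+1 + (csize c1).+1) :: compile c1 p.+1 ++
      Copy r r (p + csize c) :: compile c2 (p.+1 + (csize c1).+1)
  | CLoop r c1 => Jz r (p + csize c) :: compile c1 p.+1 ++ [:: Copy r r p]
  end.

Fixpoint cregs c : nat :=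
  match c with
  | CInc r => r
  | CCopy j i => maxn j i
  | CSeq c1 c2 => maxn (cregs c1) (cregs c2)
  | CIf r c1 c2 => maxn r (maxn (cregs c1) (cregs c2))
  | CLoop r c => maxn r (cregs c)
  end.

Lemma size_compile c p : size (compile c p) = csize c.
Proof.
elim: c p => //= [c1 IH1 c2 IH2|r c1 IH1 c2 IH2|r c1 IH1] p.
- by rewrite size_cat IH1 IH2.
- by rewrite size_cat /= IH1 IH2.
- by rewrite size_cat /= IH1 addn1.
Qed.

Lemma compile_ok k m c p : cregs c < k -> p + csize c < m -> all (instr_ok k m) (compile c p).
Proof.
elim: c p => /= [r|j i|c1 IH1 c2 IH2|r c1 IH1 c2 IH2|r c1 IH1] p hk hm.
- by rewrite hk.
- lia.
- by rewrite all_cat IH1 ?IH2; lia.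
- by rewrite all_cat /= IH1 ?IH2; lia.
- by rewrite all_cat /= IH1; lia.
Qed.

Definition code_at prog p (l : seq instr) : Prop :=
  forall i, i < size l -> nth Halt prog (p + i) = nth Halt l i.

Lemma code_at_cat prog p l l' :
  code_at prog p (l ++ l') -> code_at prog p l /\ code_at prog (p + size l) l'.
Proof.
move=> h; split=> i hi.
  by rewrite h ?nth_cat ?hi // size_cat ltn_addr.
rewrite -addnA h ?size_cat ?ltn_add2l // nth_cat; case: ltnP; first by lia.
by move=> _; congr nth; lia.
Qed.

Lemma code_at_cons prog p i l :
  code_at prog p (i :: l) -> nth Halt prog p = i /\ code_at prog p.+1 l.
Proof.
move=> h; split=> [|j hj]; first by have := h 0 isT; rewrite addn0.
by have := h j.+1 hj; rewrite addnS addSn.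
Qed.

Definition reaches prog c c' : Prop := exists t, iter t (step prog) c = c'.

Lemma reaches_refl prog c : reaches prog c c.
Proof. by exists 0. Qed.

Lemma reaches_trans prog c1 c2 c3 :
  reaches prog c1 c2 -> reaches prog c2 c3 -> reaches prog c1 c3.
Proof. by move=> [t <-] [t' <-]; exists (t' + t); rewrite iterD. Qed.

Lemma reaches_step prog c c' : reaches prog (step prog c) c' -> reaches prog c c'.
Proof. by case=> t <-; exists t.+1; rewrite iterSr. Qed.

Lemma compile_correct prog c s s' p : exec c s s' -> code_at prog p (compile c p) ->
  reaches prog (p, s) (p + csize c, s').
Proof.
move=> H; elim: H p => /= {c s s'}
  [r s|j i s|c1 c2 s s1 s2 _ IH1 _ IH2|r c1 c2 s s1 e _ IH|r c1 c2 s s1 v e _ IH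
  |r c s e|r c s s1 s2 v e _ IH1 _ IH2] p.
- by case/code_at_cons=> e _; apply: reaches_step; rewrite /= e addn1; apply: reaches_refl.
- by case/code_at_cons=> e _; apply: reaches_step; rewrite /= e addn1; apply: reaches_refl.
- case/code_at_cat=> /IH1 h1; rewrite size_compile => /IH2 h2.
  by apply: reaches_trans h1 _; rewrite addnA.
- case/code_at_cons=> h0 /code_at_cat [_ /code_at_cons [_]]; rewrite size_compile.
  rewrite -addnS => /IH h2; apply: reaches_step; rewrite /= h0 e /=.
  suff <- : p.+1 + (csize c1).+1 + csize c2 = p + (csize c1 + (csize c2).+1).+1 by [].
  lia.
- case/code_at_cons=> h0 /code_at_cat [/IH h1 /code_at_cons [h2 _]].
  rewrite size_compile in h2; apply: reaches_step; rewrite /= h0 e /=.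
  by apply: reaches_trans h1 _; apply: reaches_step; rewrite /= h2; apply: reaches_refl.
- case/code_at_cons=> h0 _; apply: reaches_step; rewrite /= h0 e /=; exact: reaches_refl.
- move=> h; have [h0 /code_at_cat [/IH1 h1 /code_at_cons [h2 _]]] := code_at_cons h.
  rewrite size_compile in h2; apply: reaches_step; rewrite /= h0 e /=.
  apply: reaches_trans h1 _; apply: reaches_step; rewrite /= h2; exact: IH2.
Qed.

(** Registers from [b + size l] on are unconstrained and so serve as scratch space; those below [b]
    belong to the caller. *)
Definition window (s0 : nat -> nat) b (l : seq nat) (s : nat -> nat) : Prop :=
  (forall r, r < b -> s r = s0 r) /\ (forall i, i < size l -> s (b + i) = nth 0 l i).
Definition transforms c b l l' : Prop :=
  forall s0 s, window s0 b l s -> exists2 s', exec c s s' & window s0 b l' s'.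

Lemma window_upd s0 b l s i v : i < size l -> window s0 b l s ->
  window s0 b (set_nth 0 l i v) (upd s (b + i) v).
Proof.
move=> hi [h1 h2]; split=> [r rb|j]; rewrite /upd.
  by rewrite h1 //; case: eqP => // e; lia.
rewrite size_set_nth (maxn_idPr hi) eqn_add2l nth_set_nth /= => hj.
by case: eqP => // _; apply: h2.
Qed.

Lemma window_id s0 b l s r : window s0 b l s -> window s0 b l (upd s r (s r)).
Proof.
have e i : upd s r (s r) i = s i by rewrite /upd; case: eqP => [->|].
by case=> h1 h2; split=> i hi; rewrite e; auto.
Qed.

(** * A calculus of register windows *)

Section Transforms.
Variable b : nat.
Implicit Types (l : seq nat) (c : com).

Lemma tr_inc i l : i < size l ->
  transforms (CInc (b + i)) b l (set_nth 0 l i (nth 0 l i).+1).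
Proof.
move=> hi s0 s hw; exists (upd s (b + i) (s (b + i)).+1); first exact: xInc.
by have [_ h] := hw; rewrite h //; apply: window_upd.
Qed.

Lemma tr_copy j i l : j < size l -> i < size l ->
  transforms (CCopy (b + j) (b + i)) b l (set_nth 0 l j (nth 0 l i)).
Proof.
move=> hj hi s0 s hw; exists (upd s (b + j) (s (b + i))); first exact: xCopy.
by have [_ h] := hw; rewrite h //; apply: window_upd.
Qed.

Lemma tr_seq c1 c2 l1 l2 l3 :
  transforms c1 b l1 l2 -> transforms c2 b l2 l3 -> transforms (CSeq c1 c2) b l1 l3.
Proof.
move=> h1 h2 s0 s /h1 [s1 x1 /h2 [s2 x2 hw]]; exists s2 => //; exact: xSeq x1 x2.
Qed.

Lemma tr_if0 i c1 c2 l l' : i < size l -> nth 0 l i = 0 ->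
  transforms c2 b l l' -> transforms (CIf (b + i) c1 c2) b l l'.
Proof.
move=> hi e h s0 s hw; have [s' x hw'] := h s0 s hw; exists s' => //.
by apply: xIf0 x; case: hw => _ ->.
Qed.

Lemma tr_ifS i c1 c2 l l' v : i < size l -> nth 0 l i = v.+1 ->
  transforms c1 b (set_nth 0 l i v) l' -> transforms (CIf (b + i) c1 c2) b l l'.
Proof.
move=> hi e h s0 s hw; have [s' x hw'] := h s0 _ (window_upd v hi hw).
exists (upd s' (b + i) (s' (b + i))); last exact: window_id.
by apply: xIfS x; case: hw => _ ->.
Qed.

Lemma tr_loop0 i c l : i < size l -> nth 0 l i = 0 -> transforms (CLoop (b + i) c) b l l.
Proof.
by move=> hi e s0 s hw; exists s => //; apply: xLoop0; case: hw => _ ->.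
Qed.

Lemma tr_loopS i c l l' l'' v : i < size l -> nth 0 l i = v.+1 ->
  transforms c b (set_nth 0 l i v) l' -> transforms (CLoop (b + i) c) b l' l'' ->
  transforms (CLoop (b + i) c) b l l''.
Proof.
move=> hi e h1 h2 s0 s hw; have [s1 x1 hw1] := h1 s0 _ (window_upd v hi hw).
have [s2 x2 hw2] := h2 s0 _ (window_id (b + i) hw1).
by exists s2 => //; apply: xLoopS x1 x2; case: hw => _ ->.
Qed.

Lemma tr_grow c l l' : (forall v, transforms c b (rcons l v) l') -> transforms c b l l'.
Proof.
move=> h s0 s [h1 h2]; apply: (h (s (b + size l))); split=> // i.
rewrite size_rcons ltnS leq_eqVlt nth_rcons => /orP [/eqP ->|hi]; last by rewrite hi h2.
by rewrite ltnn eqxx.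
Qed.

Lemma tr_shrink c l l' t : transforms c b l (l' ++ t) -> transforms c b l l'.
Proof.
move=> h s0 s /h [s' x [h1 h2]]; exists s' => //; split=> // i hi.
by rewrite h2 ?nth_cat ?hi // size_cat ltn_addr.
Qed.

Lemma tr_forget c l l' t : transforms c b l l' -> transforms c b (l ++ t) l'.
Proof.
move=> h s0 s [h1 h2]; apply: h; split=> // i hi.
by rewrite h2 ?nth_cat ?hi // size_cat ltn_addr.
Qed.

Lemma tr_frame c l1 l l' :
  transforms c (b + size l1) l l' -> transforms c b (l1 ++ l) (l1 ++ l').
Proof.
move=> h s0 s [h1 h2]; have [|s' x [h3 h4]] := h s s.
  split=> // i hi; rewrite -addnA h2 ?size_cat ?ltn_add2l // nth_cat.
  by case: ltnP; [lia | move=> _; congr nth; lia].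
exists s' => //; split=> [r rb|i].
  by rewrite h3 ?h1 // ltn_addr.
rewrite size_cat nth_cat => hi; case: ltnP => hi1.
  by rewrite h3 ?ltn_add2l // h2 ?nth_cat ?hi1 // size_cat ltn_addr.
have -> : b + i = b + size l1 + (i - size l1) by lia.
by apply: h4; lia.
Qed.

End Transforms.
Arguments tr_inc b {i l}.
Arguments tr_copy b {j i l}.
Arguments tr_if0 {b i c1 c2 l l'}.
Arguments tr_ifS {b i c1 c2 l l' v}.

(** No instruction writes a constant; the loop test does the decrementing and the body is a
    dummy. *)
Definition cclear r : com := CLoop r (CCopy r r).

Lemma tr_clear b i l : i < size l -> transforms (cclear (b + i)) b l (set_nth 0 l i 0).
Proof.
move=> hi; have [n] := ubnP (nth 0 l i); elim: n l hi => // n IH l hi hn.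
case e: (nth 0 l i) => [|v].
  have -> : set_nth 0 l i 0 = l; last exact: tr_loop0.
  apply: (@eq_from_nth _ 0); rewrite size_set_nth (maxn_idPr hi) // => j hj.
  by rewrite nth_set_nth /=; case: eqP => [->|].
have hs : size (set_nth 0 l i v) = size l by rewrite size_set_nth (maxn_idPr hi).
have hi' : i < size (set_nth 0 l i v) by rewrite hs.
apply: (tr_loopS hi e (tr_copy b hi' hi')).
rewrite set_set_nth eqxx nth_set_nth /= eqxx.
have := IH (set_nth 0 l i v); rewrite hs nth_set_nth /= eqxx set_set_nth eqxx; apply=> //.
by move: hn; rewrite e.
Qed.

Arguments tr_clear b {i l}.

Definition cunpair b : com :=
  CSeq (cclear (b + 1)) (CSeq (cclear (b + 2))
    (CLoop (b + 0) (CIf (b + 1) (CInc (b + 2))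
      (CSeq (CCopy (b + 1) (b + 2)) (CSeq (CInc (b + 1)) (cclear (b + 2))))))).

Lemma tr_unpair b x u v :
  transforms (cunpair b) b [:: x; u; v] [:: 0; (unpair x).1; (unpair x).2].
Proof.
apply: tr_seq (tr_clear b (i := 1) _) _ => //=.
apply: tr_seq (tr_clear b (i := 2) _) _ => //=.
suff h p : transforms (CLoop (b + 0) (CIf (b + 1) (CInc (b + 2))
      (CSeq (CCopy (b + 1) (b + 2)) (CSeq (CInc (b + 1)) (cclear (b + 2))))))
      b [:: x; p.1; p.2] [:: 0; (iter x cnext p).1; (iter x cnext p).2] by exact: (h (0, 0)).
elim: x p => [|x IH] [a c]; first exact: tr_loop0.
rewrite iterSr; apply: tr_loopS (IH (cnext (a, c))) => //=.
case: a => [|a].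
  apply: tr_if0 => //; apply: tr_seq (tr_copy _ (j := 1) (i := 2) _ _) _ => //=.
  apply: tr_seq (tr_inc _ (i := 1) _) _ => //=; exact: (tr_clear b (i := 2)).
by apply: tr_ifS => //=; apply: (tr_inc b (i := 2)).
Qed.

Arguments tr_unpair : clear implicits.

(** Runs [cnext] backwards from the pair in [b + 1], [b + 2] down to [(0, 0)], counting turns in
    [b]. The flag [b + 3] is cleared by the loop test and set again in every turn but the last. *)
Definition cpairing b : com :=
  CSeq (cclear (b + 0)) (CSeq (cclear (b + 3)) (CSeq (CInc (b + 3))
    (CLoop (b + 3) (CIf (b + 2)
      (CSeq (CInc (b + 1)) (CSeq (CInc (b + 0)) (CInc (b + 3))))
      (CIf (b + 1)
        (CSeq (CCopy (b + 2) (b + 1)) (CSeq (cclear (b + 1))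
          (CSeq (CInc (b + 0)) (CInc (b + 3)))))
        (CCopy (b + 0) (b + 0))))))).

Lemma tr_pairing b u a c v :
  transforms (cpairing b) b [:: u; a; c; v] [:: cpair a c; 0; 0; 0].
Proof.
apply: tr_seq (tr_clear b (i := 0) _) _ => //=.
apply: tr_seq (tr_clear b (i := 3) _) _ => //=.
apply: tr_seq (tr_inc b (i := 3) _) _ => //=.
set body := CIf (b + 2) _ _.
suff h n : transforms (CLoop (b + 3) body) b [:: n; a; c; 1] [:: n + cpair a c; 0; 0; 0].
  exact: (h 0).
move E: (cpair a c) => N; elim: N a c E n => [|N IH] a c E n.
  have [-> ->] : a = 0 /\ c = 0 by apply: cpair_inj; rewrite E.
  apply: (tr_loopS (i := 3) (v := 0) (l' := [:: n; 0; 0; 0])) => //=; last first.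
    by rewrite addn0; apply: tr_loop0.
  apply: (tr_if0 (i := 2)) => //; apply: (tr_if0 (i := 1)) => //.
  exact: (tr_copy b (j := 0) (i := 0)).
have -> : n + N.+1 = n.+1 + N by lia.
case: c E => [|c] E.
  case: a E => [//|a]; rewrite cpair_row => -[/IH h].
  apply: (tr_loopS (i := 3) (v := 0)) (h n.+1) => //=.
  apply: (tr_if0 (i := 2)) => //; apply: (tr_ifS (i := 1) (v := a)) => //=.
  apply: tr_seq (tr_copy _ (j := 2) (i := 1) _ _) _ => //=.
  apply: tr_seq (tr_clear _ (i := 1) _) _ => //=.
  apply: tr_seq (tr_inc _ (i := 0) _) _ => //=; exact: (tr_inc b (i := 3)).
move: E; rewrite cpair_up => -[/IH h].
apply: (tr_loopS (i := 3) (v := 0)) (h n.+1) => //=.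
apply: (tr_ifS (i := 2) (v := c)) => //=.
apply: tr_seq (tr_inc _ (i := 1) _) _ => //=.
apply: tr_seq (tr_inc _ (i := 0) _) _ => //=; exact: (tr_inc b (i := 3)).
Qed.

Arguments tr_pairing : clear implicits.

(* Register [b] holds the argument and then the result; the registers above it are
   scratch space. *)
Definition cprec_body (g : nat -> com) b : com :=
  CSeq (CCopy (b + 5) (b + 0)) (CSeq (CCopy (b + 6) (b + 3)) (CSeq (cpairing (b + 4))
  (CSeq (CCopy (b + 5) (b + 4)) (CSeq (CCopy (b + 4) (b + 1)) (CSeq (cpairing (b + 3))
  (CSeq (g (b + 3)) (CInc (b + 0)))))))).

Definition cmu_body (f : nat -> com) b : com :=
  CSeq (CCopy (b + 3) (b + 0)) (CSeq (CCopy (b + 4) (b + 1)) (CSeq (cpairing (b + 2)) (f (b + 2)))).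

Fixpoint ccode (c : code) (b : nat) : com :=
  match c with
  | CZero => cclear (b + 0)
  | CSucc => CInc (b + 0)
  | CId => CCopy (b + 0) (b + 0)
  | CFst => CSeq (cunpair b) (CCopy (b + 0) (b + 1))
  | CSnd => CSeq (cunpair b) (CCopy (b + 0) (b + 2))
  | CPair f g =>
      CSeq (CCopy (b + 1) (b + 0)) (CSeq (ccode f (b + 1))
      (CSeq (CCopy (b + 2) (b + 0)) (CSeq (ccode g (b + 2)) (cpairing b))))
  | CComp f g => CSeq (ccode g b) (ccode f b)
  | CPrec f g =>
      CSeq (cunpair b) (CSeq (CCopy (b + 3) (b + 1)) (CSeq (ccode f (b + 3))
      (CSeq (CLoop (b + 2) (cprec_body (ccode g) b)) (CCopy (b + 0) (b + 3)))))
  | CMu f =>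
      CSeq (cclear (b + 1)) (CSeq (cmu_body (ccode f) b)
      (CSeq (CLoop (b + 2) (CSeq (CInc (b + 1)) (cmu_body (ccode f) b))) (CCopy (b + 0) (b + 1))))
  end.

(** Collecting all stages in one sequence lets later inductions run on the counter instead of the
    derivation. *)
Lemma eval_prec f g x y : eval (CPrec f g) x y -> exists a n (ys : nat -> nat),
  [/\ x = cpair a n, eval f a (ys 0), ys n = y &
      forall i, i < n -> eval g (cpair a (cpair i (ys i))) (ys i.+1)].
Proof.
move E: (CPrec f g) => c H; elim: H f g E => // {c x y} [f g a y hf _|f g a n y z hp IH hg _] f' g' [-> ->].
  by exists a, 0, (fun=> y).
have [a' [n' [ys [/cpair_inj [<- <-] h1 h2 h3]]]] := IH _ _ erefl.
exists a, n.+1, (fun i => if i == n.+1 then z else ys i); rewrite eqxx; split=> // i.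
rewrite ltnS leq_eqVlt eqSS => /orP [/eqP ->|hi].
  by rewrite eqxx ltn_eqF // h2.
by rewrite !ltn_eqF ?ltnS //; [apply: h3 | apply: ltnW].
Qed.

Lemma ccode_correct c x y b : eval c x y -> transforms (ccode c b) b [:: x] [:: y].
Proof.
elim: c x y b => [||||| f IHf g IHg | f IHf g IHg | f IHf g IHg | f IHf] x y b /= H.
- by inversion H; subst; apply: (tr_clear b (i := 0)).
- by inversion H; subst; apply: (tr_inc b (i := 0)).
- by inversion H; subst; apply: (tr_copy b (j := 0) (i := 0)).
- inversion H; subst; apply: tr_grow => u; apply: tr_grow => v /=.
  apply: tr_seq (tr_unpair _ _ _ _) _; rewrite cpairK /=.
  apply: (@tr_shrink b _ _ [:: _] [:: _; _]); exact: (tr_copy b (j := 0) (i := 1)).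
- inversion H; subst; apply: tr_grow => u; apply: tr_grow => v /=.
  apply: tr_seq (tr_unpair _ _ _ _) _; rewrite cpairK /=.
  apply: (@tr_shrink b _ _ [:: _] [:: _; _]); exact: (tr_copy b (j := 0) (i := 2)).
- inversion H as [| | | | |f' g' x' y1 y2 h1 h2| | | |]; subst.
  apply: tr_grow => u /=; apply: tr_seq (tr_copy _ (j := 1) (i := 0) _ _) _ => //=.
  apply: tr_seq (@tr_frame b _ [:: x] _ _ (IHf _ _ _ h1)) _ => /=.
  apply: tr_grow => v /=; apply: tr_seq (tr_copy _ (j := 2) (i := 0) _ _) _ => //=.
  apply: tr_seq (@tr_frame b _ [:: x; y1] _ _ (IHg _ _ _ h2)) _ => /=.
  apply: tr_grow => w /=.
  apply: (@tr_shrink b _ _ [:: _] [:: 0; 0; 0]); exact: (tr_pairing _ _ _ _ _).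
- inversion H as [| | | | | |f' g' x' y1 y2 h1 h2| | |]; subst.
  exact: tr_seq (IHg _ _ _ h1) (IHf _ _ _ h2).
- have [a [n [ys [-> h1 <- h2]]]] := eval_prec H.
  apply: tr_grow => u; apply: tr_grow => v /=.
  apply: tr_seq (tr_unpair _ _ _ _) _; rewrite cpairK /=.
  apply: tr_grow => w /=; apply: tr_seq (tr_copy _ (j := 3) (i := 1) _ _) _ => //=.
  apply: tr_seq (@tr_frame b _ [:: 0; a; n] _ _ (IHf _ _ _ h1)) _ => /=.
  apply: (tr_seq (l2 := [:: n; a; 0; ys n])); last first.
    apply: (@tr_shrink b _ _ [:: _] [:: _; _; _]); exact: (tr_copy b (j := 0) (i := 3)).
  (* The window holds the stage, the parameter, the remaining turns and the current value; the 0
     that unpairing leaves in [b] is the first stage. *)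
  have h i j : i + j = n -> transforms (CLoop (b + 2) (cprec_body (ccode g) b)) b
      [:: i; a; j; ys i] [:: n; a; 0; ys n].
    elim: j i => [|j IHj] i e.
      by rewrite addn0 in e; rewrite e; apply: (tr_loop0 (i := 2)).
    have lt_i : i < n by lia.
    apply: (tr_loopS (i := 2) (v := j)) (IHj i.+1 _) => //=; last by lia.
    rewrite /cprec_body; do 4! (apply: tr_grow => ? /=).
    apply: tr_seq (tr_copy _ (j := 5) (i := 0) _ _) _ => //=.
    apply: tr_seq (tr_copy _ (j := 6) (i := 3) _ _) _ => //=.
    apply: tr_seq (@tr_frame b _ [:: _; _; _; _] _ _ (tr_pairing _ _ _ _ _)) _ => /=.
    apply: tr_seq (tr_copy _ (j := 5) (i := 4) _ _) _ => //=.
    apply: tr_seq (tr_copy _ (j := 4) (i := 1) _ _) _ => //=.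
    apply: (@tr_forget b _ [:: _; _; _; _; _; _; _] _ [:: 0]).
    apply: tr_seq (@tr_frame b _ [:: _; _; _] _ _ (tr_pairing _ _ _ _ _)) _ => /=.
    apply: (@tr_forget b _ [:: _; _; _; _] _ [:: 0; 0; 0]).
    apply: tr_seq (@tr_frame b _ [:: _; _; _] _ _ (IHg _ _ _ (h2 _ lt_i))) _ => /=.
    exact: (tr_inc b (i := 0)).
  by apply: h; rewrite add0n.
- inversion H as [| | | | | | | | |f' x' n h1 h2]; subst.
  have hb m z u : eval f (cpair x m) z ->
      transforms (cmu_body (ccode f) b) b [:: x; m; u] [:: x; m; z].
    move=> hz; rewrite /cmu_body; do 3! (apply: tr_grow => ? /=).
    apply: tr_seq (tr_copy _ (j := 3) (i := 0) _ _) _ => //=.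
    apply: tr_seq (tr_copy _ (j := 4) (i := 1) _ _) _ => //=.
    apply: tr_seq (@tr_frame b _ [:: _; _] _ _ (tr_pairing _ _ _ _ _)) _ => /=.
    apply: (@tr_forget b _ [:: _; _; _] _ [:: 0; 0; 0]).
    exact: (@tr_frame b _ [:: _; _] _ _ (IHf _ _ _ hz)).
  (* The third register holds the value of [f] at the candidate [m]; the loop stops when it is 0,
     that is, at [m = y]. *)
  have hl m z : m <= y -> eval f (cpair x m) z -> (m = y -> z = 0) ->  (m < y -> z != 0) ->
      transforms (CLoop (b + 2) (CSeq (CInc (b + 1)) (cmu_body (ccode f) b))) b
        [:: x; m; z] [:: x; y; 0].
    have [d] := ubnP (y - m); elim: d m z => // d IHd m z hd my hz e0 en0.
    move: my; rewrite leq_eqVlt => /orP [/eqP e|lt_m].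
      by rewrite e0 // e; apply: (tr_loop0 (i := 2)).
    case: z hz e0 en0 => [|z] hz e0 en0; first by have := en0 lt_m.
    have [z' [hz' e0' en0']] : exists z', [/\ eval f (cpair x m.+1) z',
        m.+1 = y -> z' = 0 & m.+1 < y -> z' != 0].
      have [e|ne] := eqVneq m.+1 y; first by exists 0; split=> //; rewrite e ?ltnn.
      by have [|z' hz'] := h2 m.+1; [lia | exists z'.+1; split=> // e; rewrite e eqxx in ne].
    apply: (tr_loopS (i := 2) (v := z)) (IHd m.+1 z' _ _ hz' e0' en0') => //=; last by lia.
    apply: tr_seq (tr_inc _ (i := 1) _) _ => //=; exact: hb.
  have [z [hz e0 en0]] : exists z, [/\ eval f (cpair x 0) z,
      0 = y -> z = 0 & 0 < y -> z != 0].
    have [e|ne] := posnP y; first by exists 0; split=> //; rewrite -{1}e.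
    by have [z hz] := h2 0 ne; exists z.+1; split=> // e; rewrite -e in ne.
  apply: tr_grow => u; apply: tr_grow => v /=.
  apply: tr_seq (tr_clear _ (i := 1) _) _ => //=.
  apply: tr_seq (hb 0 z v hz) _; apply: tr_seq (hl 0 z _ hz e0 en0) _ => //.
  apply: (@tr_shrink b _ _ [:: _] [:: _; _]); exact: (tr_copy b (j := 0) (i := 1)).
Qed.

(** The last test sits at address [csize]: a nonzero result falls through to the accepting address,
    and 0 jumps to the one after it. *)
Definition code_prog (c : code) : seq instr :=
  rcons (compile (ccode c 0) 0) (Jz 0 (csize (ccode c 0)).+2).
Definition code_regs (c : code) : nat := (cregs (ccode c 0)).+1.

Lemma size_code_prog c : size (code_prog c) = (csize (ccode c 0)).+1.
Proof. by rewrite size_rcons size_compile. Qed.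

Lemma code_prog_ok c : all (instr_ok (code_regs c) (size (code_prog c)).+2) (code_prog c).
Proof.
rewrite size_code_prog all_rcons /= compile_ok //; lia.
Qed.

Lemma code_prog_run c x y : eval c x y ->
  exists t, (run (code_prog c) x t).1 = size (code_prog c) + (y == 0).
Proof.
move=> hc; rewrite size_code_prog; set s := upd (fun=> 0) 0 x.
have hw : window s 0 [:: x] s by split=> // -[|i].
have [s' hx [_ hs']] := ccode_correct hc hw.
have [|t ht] := compile_correct (prog := code_prog c) (p := 0) hx.
  by move=> i hi; rewrite nth_rcons add0n hi.
exists t.+1; rewrite /run iterS ht /= nth_rcons size_compile ltnn eqxx.
have -> : s' 0 = y by exact: (hs' 0).
by case: y {hc hs'} => [|y] /=; rewrite ?addn1 ?addn0.
Qed.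

Definition code_instance (c : code) x : instance :=
  machine_instance (code_regs c) (code_prog c) x.

Lemma code_accepts c x y : eval c x y.+1 -> FD (code_instance c x).
Proof.
case/code_prog_run=> t; rewrite addn0 => ht; apply: machine_accepts ht => //.
- by rewrite size_code_prog.
- exact: code_prog_ok.
Qed.

Lemma code_rejects c x : eval c x 0 -> ~ FD (code_instance c x).
Proof.
case/code_prog_run=> t; rewrite addn1 => ht; apply: machine_rejects ht => //.
- by rewrite size_code_prog.
- exact: code_prog_ok.
Qed.

(** * A universal mu-recursive function *)

Arguments cpair : simpl never.

Definition p1 z := (unpair z).1.
Definition p2 z := (unpair z).2.

Lemma p1E a b : p1 (cpair a b) = a.
Proof. by rewrite /p1 cpairK. Qed.

Lemma p2E a b : p2 (cpair a b) = b.
Proof. by rewrite /p2 cpairK. Qed.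

(** * Closure properties of computable functions *)

Definition comput (f : nat -> nat) : Prop := exists c, forall x, eval c x (f x).

Section Computable.
Implicit Types f g h n : nat -> nat.

Lemma comput_ext f g : f =1 g -> comput f -> comput g.
Proof. by move=> e [c h]; exists c => x; rewrite -e. Qed.

Lemma comput_id : comput (fun x => x).
Proof. by exists CId => x; apply: eId. Qed.

Lemma comput_comp g f : comput g -> comput f -> comput (fun x => g (f x)).
Proof. by move=> [c hc] [d hd]; exists (CComp c d) => x; apply: eComp (hd x) (hc _). Qed.

Lemma comput_S f : comput f -> comput (fun x => (f x).+1).
Proof. by apply: comput_comp; exists CSucc => x; apply: eSucc. Qed.

Lemma comput_cst k : comput (fun=> k).
Proof.
elim: k => [|k IH]; first by exists CZero => x; apply: eZero.
exact: comput_S IH.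
Qed.

Lemma comput_pair f g : comput f -> comput g -> comput (fun x => cpair (f x) (g x)).
Proof. by move=> [c hc] [d hd]; exists (CPair c d) => x; apply: ePair. Qed.

Lemma comput_p1 f : comput f -> comput (fun x => p1 (f x)).
Proof.
by apply: comput_comp; exists CFst => x; rewrite -{1}(unpairK x); apply: eFst.
Qed.

Lemma comput_p2 f : comput f -> comput (fun x => p2 (f x)).
Proof.
by apply: comput_comp; exists CSnd => x; rewrite -{1}(unpairK x); apply: eSnd.
Qed.

Fixpoint recn (a : nat -> nat) (h : nat -> nat -> nat -> nat) p k : nat :=
  if k is k'.+1 then h p k' (recn a h p k') else a p.

Lemma comput_rec (a : nat -> nat) (h : nat -> nat -> nat -> nat) f n :
  comput a -> comput (fun z => h (p1 z) (p1 (p2 z)) (p2 (p2 z))) ->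
  comput f -> comput n -> comput (fun x => recn a h (f x) (n x)).
Proof.
move=> [ca ha] [ch hh] hf hn.
have hr : comput (fun z => recn a h (p1 z) (p2 z)).
  exists (CPrec ca ch) => z; rewrite -{1}(unpairK z) -/(p1 z) -/(p2 z).
  elim: (p2 z) => [|k IH] /=; first exact: ePrec0.
  by apply: ePrecS IH _; have := hh (cpair (p1 z) (cpair k (recn a h (p1 z) k)));
    rewrite !(p1E, p2E).
apply: comput_ext (comput_comp hr (comput_pair hf hn)) => x.
by rewrite p1E p2E.
Qed.

Lemma comput_iter g f n :
  comput g -> comput f -> comput n -> comput (fun x => iter (n x) g (f x)).
Proof.
move=> hg hf hn; apply: comput_ext (comput_rec (h := fun _ _ r => g r) comput_id _ hf hn).
  by move=> x; elim: (n x) => //= k ->.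
by apply: comput_comp hg _; do 2 apply: comput_p2; apply: comput_id.
Qed.

Lemma comput_pred f : comput f -> comput (fun x => (f x).-1).
Proof.
move=> hf; apply: comput_ext
  (comput_rec (a := fun=> 0) (h := fun _ k _ => k) (comput_cst 0) _ (comput_cst 0) hf).
  by move=> x; case: (f x).
by apply/comput_p1/comput_p2/comput_id.
Qed.

Lemma comput_if f g h : comput f -> comput g -> comput h ->
  comput (fun x => if f x == 0 then g x else h x).
Proof.
move=> hf hg hh; apply: comput_ext
  (comput_rec (h := fun p _ _ => h p) hg _ comput_id hf).
  by move=> x; case: (f x).
exact/comput_comp/comput_p1/comput_id.
Qed.

Lemma comput_add f g : comput f -> comput g -> comput (fun x => f x + g x).
Proof.
move=> hf hg; apply: comput_ext (comput_iter (comput_S comput_id) hf hg) => x.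
by rewrite addnC; elim: (g x) => //= k ->.
Qed.

Lemma comput_mul f g : comput f -> comput g -> comput (fun x => f x * g x).
Proof.
move=> hf hg; apply: comput_ext (comput_rec (a := fun=> 0) (h := fun p _ r => p + r)
  (comput_cst 0) _ hg hf).
  by move=> x; elim: (f x) => //= k ->; rewrite mulSn.
apply: comput_add; first exact/comput_p1/comput_id.
exact/comput_p2/comput_p2/comput_id.
Qed.

Lemma comput_double f : comput f -> comput (fun x => (f x).*2).
Proof.
move=> hf; apply: comput_ext (comput_add hf hf) => x; exact: addnn.
Qed.

Lemma comput_switch_nil f : comput (fun x => nth 0 [::] (f x)).
Proof. by apply: comput_ext (comput_cst 0) => x; rewrite nth_nil. Qed.

Lemma comput_switch_cons f g (s : nat -> seq nat) : comput f -> comput g ->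
  comput (fun x => nth 0 (s x) (f x).-1) -> comput (fun x => nth 0 (g x :: s x) (f x)).
Proof.
move=> hf hg hs; apply: comput_ext (comput_if hf hg hs) => x; by case: (f x).
Qed.

(** The step of [CodeSeq.code], by which [pickle] encodes lists and pairs. *)
Definition ccons (n m : nat) := 2 ^ n * m.*2.+1.

Lemma comput_ccons f g : comput f -> comput g -> comput (fun x => ccons (f x) (g x)).
Proof.
move=> hf hg; apply: comput_ext
  (comput_iter (comput_double comput_id) (comput_S (comput_double hg)) hf) => x.
by rewrite /ccons; elim: (f x) => [|n /= ->]; rewrite ?mul1n // expnS -mul2n mulnA.
Qed.

End Computable.

Ltac comput_step :=
  lazymatch goal with
  | |- comput (fun x => x) => apply: comput_id
  | |- comput p1 => apply: (comput_p1 comput_id)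
  | |- comput p2 => apply: (comput_p2 comput_id)
  | |- comput S => apply: (comput_S comput_id)
  | |- comput (fun x => cpair _ _) => apply: comput_pair
  | |- comput (fun x => S _) => apply: comput_S
  | |- comput (fun x => p1 _) => apply: comput_p1
  | |- comput (fun x => p2 _) => apply: comput_p2
  | |- comput (fun x => _ + _) => apply: comput_add
  | |- comput (fun x => _ * _) => apply: comput_mul
  | |- comput (fun x => ccons _ _) => apply: comput_ccons
  | |- comput (fun x => _.*2) => apply: comput_double
  | |- comput (fun x => _.-1) => apply: comput_pred
  | |- comput (fun x => if _ == 0 then _ else _) => apply: comput_if
  | |- comput (fun x => nth 0 [::] _) => apply: comput_switch_nil
  | |- comput (fun x => nth 0 (_ :: _) _) => apply: comput_switch_cons
  | |- _ => first [apply: comput_cst | assumption]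
  end.
Ltac comput_tac := cbv beta; repeat comput_step.

(** * An abstract machine evaluating quoted codes *)

Definition push o K := (cpair o K).+1.

Fixpoint quote (c : code) : nat :=
  match c with
  | CZero => cpair 0 0
  | CSucc => cpair 1 0
  | CId => cpair 2 0
  | CFst => cpair 3 0
  | CSnd => cpair 4 0
  | CPair f g => cpair 5 (cpair (quote f) (quote g))
  | CComp f g => cpair 6 (cpair (quote f) (quote g))
  | CPrec f g => cpair 7 (cpair (quote f) (quote g))
  | CMu f => cpair 8 (quote f)
  end.

(* An abstract machine with state [cpair v K]: the top operation of the stack [K] is
   applied to the value [v]. Operations with tags 0-8 are quoted codes; tags 9 and 12
   are pending pairings, 10 a pending primitive recursion, 11 a pending search. *)
Definition branches (v o K : nat) : seq nat :=
  let d := p2 o in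
  [:: cpair 0 K; cpair v.+1 K; cpair v K; cpair (p1 v) K; cpair (p2 v) K;
      cpair v (push (p1 d) (push (cpair 9 (cpair (p2 d) v)) K));
      cpair v (push (p2 d) (push (p1 d) K));
      if p2 v == 0 then cpair (p1 v) (push (p1 d) K)
      else cpair (cpair (p1 v) (p2 v).-1)
             (push o (push (cpair 10 (cpair (p2 d) (cpair (p1 v) (p2 v).-1))) K));
      cpair (cpair v 0) (push d (push (cpair 11 (cpair d (cpair v 0))) K));
      cpair (p2 d) (push (p1 d) (push (cpair 12 v) K));
      cpair (cpair (p1 (p2 d)) (cpair (p2 (p2 d)) v)) (push (p1 d) K);
      if v == 0 then cpair (p2 (p2 d)) K
      else cpair (cpair (p1 (p2 d)) (p2 (p2 d)).+1)
             (push (p1 d) (push (cpair 11 (cpair (p1 d)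
                (cpair (p1 (p2 d)) (p2 (p2 d)).+1))) K));
      cpair (cpair d v) K].

(** [push] never yields 0, so the stack 0 is the empty one; such a state is final and stays
    fixed. *)
Definition ustep (z : nat) : nat :=
  if p2 z == 0 then z
  else nth 0 (branches (p1 z) (p1 (p2 z).-1) (p2 (p2 z).-1)) (p1 (p1 (p2 z).-1)).

Lemma comput_ustep : comput ustep.
Proof. by rewrite /ustep /branches /push; comput_tac. Qed.

Lemma ustepE v t d K :
  ustep (cpair v (push (cpair t d) K)) = nth 0 (branches v (cpair t d) K) t.
Proof. by rewrite /ustep /push !(p1E, p2E). Qed.

Definition usteps z z' : Prop := exists t, iter t ustep z = z'.

Lemma usteps_trans z1 z2 z3 : usteps z1 z2 -> usteps z2 z3 -> usteps z1 z3.
Proof. by move=> [t <-] [t' <-]; exists (t' + t); rewrite iterD. Qed.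

Lemma usteps1 z z' : usteps (ustep z) z' -> usteps z z'.
Proof. by case=> t <-; exists t.+1; rewrite iterSr. Qed.

Lemma usteps_refl z : usteps z z.
Proof. by exists 0. Qed.

Lemma usteps_branch v t d K z : usteps (nth 0 (branches v (cpair t d) K) t) z ->
  usteps (cpair v (push (cpair t d) K)) z.
Proof. by move=> h; apply: usteps1; rewrite ustepE. Qed.

Lemma usteps_eval c x y K : eval c x y -> usteps (cpair x (push (quote c) K)) (cpair y K).
Proof.
elim: c x y K => [||||| f IHf g IHg | f IHf g IHg | f IHf g IHg | f IHf] x y K H; rewrite [quote _]/=.
- by inversion H; subst; apply: usteps_branch; apply: usteps_refl.
- by inversion H; subst; apply: usteps_branch; apply: usteps_refl.
- by inversion H; subst; apply: usteps_branch; apply: usteps_refl.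
- by inversion H; subst; apply: usteps_branch => /=; rewrite p1E; apply: usteps_refl.
- by inversion H; subst; apply: usteps_branch => /=; rewrite p2E; apply: usteps_refl.
- inversion H as [| | | | |f' g' x' y1 y2 h1 h2| | | |]; subst.
  apply: usteps_branch; rewrite /= !(p1E, p2E); apply: usteps_trans (IHf _ _ _ h1) _.
  apply: usteps_branch; rewrite /= !(p1E, p2E); apply: usteps_trans (IHg _ _ _ h2) _.
  by apply: usteps_branch; rewrite /= !(p1E, p2E); apply: usteps_refl.
- inversion H as [| | | | | |f' g' x' y1 y2 h1 h2| | |]; subst.
  apply: usteps_branch; rewrite /= !(p1E, p2E); apply: usteps_trans (IHg _ _ _ h1) _; exact: IHf.
- have [a [n [ys [-> h1 <- h2]]]] := eval_prec H.
  elim: n {H} K h2 => [|n IHn] K h2.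
    by apply: usteps_branch; rewrite /= !(p1E, p2E) /=; apply: IHf.
  apply: usteps_branch; rewrite /= ?(p1E, p2E) /= ?(p1E, p2E).
  apply: usteps_trans (IHn _ _) _; first by move=> i hi; apply: h2; apply: ltnW.
  apply: usteps_branch; rewrite /= !(p1E, p2E); exact: IHg (h2 n (ltnSn n)).
- inversion H as [| | | | | | | | |f' x' n h1 h2]; subst.
  apply: usteps_branch; rewrite /= !(p1E, p2E).
  have h m : m <= y -> usteps (cpair (cpair x m) (push (quote f)
      (push (cpair 11 (cpair (quote f) (cpair x m))) K))) (cpair y K).
    have [d] := ubnP (y - m); elim: d m => // d IHd m hd; rewrite leq_eqVlt.
    case/orP=> [/eqP ->|lt_m].
      apply: usteps_trans (IHf _ _ _ h1) _.
      by apply: usteps_branch; rewrite /= !(p1E, p2E); apply: usteps_refl.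
    have [z hz] := h2 _ lt_m; apply: usteps_trans (IHf _ _ _ hz) _.
    by apply: usteps_branch; rewrite /= !(p1E, p2E); apply: IHd; lia.
  exact: h.
Qed.

(** Diagonalization asks for self-application only. Minimization finds the first time with empty
    stack, and final states being fixed, the value read then is the value at any later time. *)
Theorem universal : exists u, forall c y, eval c (quote c) y -> eval u (quote c) y.
Proof.
pose start x := cpair x (push x 0).
have hs n : comput n -> comput (fun z => iter (n z) ustep (start (p1 z))).
  move=> hn; apply: comput_iter => //; first exact: comput_ustep.
  by rewrite /start /push; comput_tac.
have [test htest] : comput (fun z => p2 (iter (p2 z) ustep (start (p1 z)))).
  exact/comput_p2/hs/comput_p2/comput_id.
have [out hout] : comput (fun z => p1 (iter (p2 z) ustep (start (p1 z)))).
  exact/comput_p1/hs/comput_p2/comput_id.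
exists (CComp out (CPair CId (CMu test))) => c y hc; set x := quote c in hc *.
have [t ht] := usteps_eval 0 hc.
have ex : exists n, p2 (iter n ustep (start x)) == 0 by exists t; rewrite ht p2E.
case: (ex_minnP ex) => n /eqP hn hmin.
have hy : p1 (iter n ustep (start x)) = y.
  have nt : n <= t by apply: hmin; rewrite ht p2E.
  have stuck d : iter d ustep (iter n ustep (start x)) = iter n ustep (start x).
    by elim: d => //= d ->; rewrite {1}/ustep hn.
  by rewrite -(stuck (t - n)) -iterD subnK // ht p1E.
apply: (@eComp _ _ _ (cpair x n)); last first.
  by have := hout (cpair x n); rewrite p1E p2E hy.
apply: ePair; first exact: eId.
apply: eMu; first by have := htest (cpair x n); rewrite p1E p2E hn.
move=> m lt_m; have := htest (cpair x m); rewrite p1E p2E.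
case e: (p2 _) => [|k]; last by exists k.
by have := hmin m; rewrite e eqxx => /(_ isT); rewrite leqNgt lt_m.
Qed.

(** * Computability of the reduction *)

Lemma comput_foldr (T : Type) (s : seq T) (F : T -> nat -> nat) a :
  (forall j, comput (F j)) -> comput a ->
  comput (fun x => foldr ccons (a x) [seq F j x | j <- s]).
Proof.
by move=> hF ha; elim: s => [//|j s IH] /=; apply: comput_ccons.
Qed.

Lemma code_cat (s s' : seq nat) :
  CodeSeq.code (s ++ s') = foldr ccons (CodeSeq.code s') s.
Proof. exact: foldr_cat. Qed.

Section Encoding.
Variable n : nat.

Lemma comput_spider M i v w a :
  comput i -> comput v -> comput w -> comput a ->
  comput (fun x => foldr ccons (a x)
    (map pickle (spider_atoms n (i x) (M, (v x, w x))))).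
Proof.
move=> hi hv hw ha.
(* The code of the variable [(false, m)]: a pair is coded like a list of two entries, and [false] is
   coded by 0. *)
pose term_code m := ccons 0 (ccons m 0).
pose knee j x := (i x * n + j).*2.+1.
have hk j : comput (fun x => term_code (knee j x)) by rewrite /term_code /knee; comput_tac.
have hT m : comput m -> comput (fun x => term_code (m x)).
  by move=> hm; rewrite /term_code; comput_tac.
apply: comput_ext (_ : comput (fun x => ccons
  (ccons 0 (ccons (ccons (term_code (v x).*2) (ccons (term_code (w x).*2)
     (foldr ccons 0 [seq term_code (knee j x) | j <- iota 0 n]))) 0))
  (foldr ccons (a x) [seq ccons 1 (ccons (ccons (term_code (knee j x)) 0) 0)
     | j <- iota 0 n & j \notin M]))) => [x|].
  transitivity (foldr ccons (a x) (pickle ((0, [:: nvar (v x), nvar (w x) &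
      [seq kvar n (i x) j | j <- iota 0 n]]) : atom) ::
    map pickle [seq (1, [:: kvar n (i x) j]) : atom | j <- iota 0 n & j \notin M])); last by [].
  rewrite -map_comp; congr ccons; congr (ccons 0 (ccons (ccons _ (ccons _ _)) 0)).
  exact: (congr1 CodeSeq.code (map_comp (@pickle _) (kvar n (i x)) (iota 0 n))).
apply: comput_ccons; last first.
  by apply: comput_foldr => // j; have hkj := hk j; comput_tac.
comput_tac; try exact/hT/comput_double.
by apply: comput_foldr => //; apply: comput_cst.
Qed.

Definition atoms_code (sp : seq spider) : nat :=
  CodeSeq.code (map (@pickle atom) (spiders_atoms n sp)).
Definition knees_code (sp : seq spider) : nat := CodeSeq.code (knees n sp).

Lemma atoms_code_cons s sp :
  atoms_code (s :: sp) = foldr ccons (atoms_code sp) (map pickle (spider_atoms n (size sp) s)).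
Proof. by rewrite /atoms_code -code_cat -map_cat. Qed.

Lemma knees_code_cons s sp : knees_code (s :: sp) =
  foldr ccons (knees_code sp) [seq (size sp * n + j).*2.+1 | j <- s.1].
Proof. by rewrite /knees_code -code_cat. Qed.

Lemma pickle_query sp :
  pickle (query n [::] sp) = ccons (knees_code sp) (ccons (atoms_code sp) 0).
Proof.
transitivity (ccons (CodeSeq.code (map id (knees n sp))) (ccons (atoms_code sp) 0)) => //.
by rewrite map_id.
Qed.

Lemma comput_knees M i a : comput i -> comput a ->
  comput (fun x => foldr ccons (a x) [seq (i x * n + j).*2.+1 | j <- M]).
Proof. by move=> hi ha; apply: comput_foldr => // j; comput_tac. Qed.

Definition comput_spiders (sp : nat -> seq spider) : Prop :=
  [/\ comput (fun x => size (sp x)), comput (fun x => atoms_code (sp x))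
    & comput (fun x => knees_code (sp x))].

Lemma comput_spiders_cons M v w sp : comput v -> comput w -> comput_spiders sp ->
  comput_spiders (fun x => (M, (v x, w x)) :: sp x).
Proof.
move=> hv hw [hs ha hk]; split; first exact: comput_S.
  by apply: comput_ext (comput_spider M hs hv hw ha) => x; rewrite atoms_code_cons.
by apply: comput_ext (comput_knees M hs hk) => x; rewrite knees_code_cons.
Qed.

(** Because spiders are numbered from the end, lengthening the chain only prepends atoms and leaves
    the old ones intact, so the code is defined by primitive recursion on [x]. *)
Lemma comput_start_spiders L k :
  comput_spiders (fun x => map (fact_spider L) (start_facts k x)).
Proof.
pose base := map (fact_spider L) (base_facts k).
pose sp x := map (fact_spider L) (chain x) ++ base.
have spS x : sp x.+1 = ([:: L + lOne], (x.+2, x.+1)) :: sp x by [].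
have ssp x : size (sp x) = x + size base.
  by elim: x => // x IH; rewrite spS /= IH.
suff h : comput_spiders sp.
  have := comput_spiders_cons [:: L + reg 0] (comput_cst 0) (comput_S comput_id)
    (comput_spiders_cons [:: L + lE] (comput_S comput_id) (comput_S comput_id) h).
  rewrite /comput_spiders /sp /base => -[h1 h2 h3]; split.
  - by apply: comput_ext h1 => x; rewrite -map_cat.
  - by apply: comput_ext h2 => x; rewrite -map_cat.
  - by apply: comput_ext h3 => x; rewrite -map_cat.
have hs : comput (fun z => p1 (p2 z) + size base) by comput_tac.
split.
- by apply: comput_ext (_ : comput (fun x => x + size base)) => [x|]; [rewrite ssp|comput_tac].
- apply: comput_ext (comput_rec (a := fun=> atoms_code base) (h := fun _ i r =>
    foldr ccons r (map pickle (spider_atoms n (i + size base) ([:: L + lOne], (i.+2, i.+1)))))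
    (comput_cst _) _ (comput_cst 0) comput_id) => [x|].
    by elim: x => [//|x IH]; rewrite spS [RHS]atoms_code_cons ssp -IH.
  by apply: comput_spider => //; comput_tac.
- apply: comput_ext (comput_rec (a := fun=> knees_code base) (h := fun _ i r =>
    foldr ccons r [seq ((i + size base) * n + j).*2.+1 | j <- [:: L + lOne]])
    (comput_cst _) _ (comput_cst 0) comput_id) => [x|].
    by elim: x => [//|x IH]; rewrite spS [RHS]knees_code_cons ssp -IH.
  by apply: comput_knees => //; comput_tac.
Qed.

End Encoding.

Lemma comput_encode u : comput (fun x => encode (code_instance u x)).
Proof.
set k := code_regs u; set P := code_prog u; set L := num_labels k P.
(* For fixed [u] the input enters through the initial view only; all other views form a constant. *)
pose rest := CodeSeq.code (map (@pickle cq) (bad_query L (st (size P)) ::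
  map (rule_query L) (all_rules L (machine_rules k P)))).
have e x : encode (code_instance u x) =
  ccons (ccons (pickle (sig (L + L))) (ccons (ccons
    (pickle (init_query L (start_facts k x))) rest) 0))
  (ccons (pickle (goal_query L)) 0) by [].
have [_ ha hk] := comput_start_spiders (L + L) L k.
apply: comput_ext (_ : comput (fun x => ccons (ccons (pickle (sig (L + L))) (ccons (ccons
    (ccons (knees_code (L + L) (map (fact_spider L) (start_facts k x)))
      (ccons (atoms_code (L + L) (map (fact_spider L) (start_facts k x))) 0)) rest) 0))
  (ccons (pickle (goal_query L)) 0))) => [x|].
  by rewrite e -pickle_query.
by comput_tac.
Qed.

Theorem theorem1 :
  ~ exists e : code,
      forall I : instance, wf_instance I ->
        (FD I -> eval e (encode I) 1) /\ (~ FD I -> eval e (encode I) 0).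
Proof.
case=> e he; have [u hu] := universal; have [enc henc] := comput_encode u.
have [flip hflip] : comput (fun x => if x == 0 then 1 else 0) by comput_tac.
(* On its own quotation [d] returns the opposite of the verdict of [e] about the instance that
   simulates exactly this computation. *)
pose d := CComp flip (CComp e enc).
have hd b : eval e (encode (code_instance u (quote d))) b ->
    eval u (quote d) (if b == 0 then 1 else 0).
  by move=> h; apply: hu; apply: eComp _ (hflip b); apply: eComp (henc _) h.
have [h1 h0] := he (code_instance u (quote d)) (wf_system _ _ _ _).
(* No case distinction on determinacy is made: assuming it leads to its own refutation, and the
   resulting verdict 0 then makes the run accept. *)
have nFD : ~ FD (code_instance u (quote d)).
  by move=> h; apply: (code_rejects _ h); apply: (hd 1); apply: h1.
by apply: (nFD); apply: (@code_accepts _ _ 0); exact: (hd 0 (h0 nFD)).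
Qed.
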